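(* Let $\Omega\subset\mathbb{R}^d$ be an open and bounded Lipschitz domain, and let $\rho_0,\rho_1\in BV(\Omega)\cap L^\infty(\Omega)$ be non-negative functions with $\operatorname{ess\,inf}_\Omega(\rho_0+\rho_1)>0$; write $\boldsymbol{\rho}=(\rho_0,\rho_1)$. Then for any sequence $(\varepsilon_k)_{k\in\mathbb{N}}\subset(0,\infty)$ with $\lim_{k\to\infty}\varepsilon_k=0$ and any collection of measurable sets $A_k\subset\Omega$ with $\limsup_{k\to\infty}\mathrm{Per}_{\varepsilon_k}(A_k;\boldsymbol{\rho})<\infty$, there are a subsequence (not relabeled) and a set $A\subset\Omega$ such that $$\chi_{A_k}\to\chi_A \text{ in } L^1(\Omega)\quad\text{and}\quad A \text{ is a set of finite perimeter in } \Omega.$$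
   Context: $B(x,r)$ denotes the open Euclidean ball of radius $r$ around $x$ and $\chi_A$ the characteristic function of $A$. For measurable $A\subset\Omega$ and $\varepsilon>0$ the nonlocal perimeter is $$\mathrm{Per}_\varepsilon(A;\boldsymbol{\rho}):=\frac1\varepsilon\int_\Omega\Big(\operatorname*{ess\,sup}_{B(x,\varepsilon)\cap\Omega}\chi_A-\chi_A(x)\Big)\rho_0(x)\,dx+\frac1\varepsilon\int_\Omega\Big(\chi_A(x)-\operatorname*{ess\,inf}_{B(x,\varepsilon)\cap\Omega}\chi_A\Big)\rho_1(x)\,dx,$$ with essential supremum/infimum taken with respect to Lebesgue measure. A set $A$ has finite perimeter in $\Omega$ if $\chi_A\in BV(\Omega)$. *)

(* Defs.v *)
From HB Require Import structures.
From mathcomp Require Import all_boot all_order all_algebra.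
From mathcomp Require Import all_classical all_reals all_analysis.

Set Implicit Arguments.
Unset Strict Implicit.
Unset Printing Implicit Defensive.

Import Order.TTheory GRing.Theory Num.Theory.
Import numFieldNormedType.Exports.

Local Open Scope classical_set_scope.
Local Open Scope ring_scope.

(* R^d, with d >= 1, is 'rV[R]_n.+1, with d = n.+1.  Its library topology and
   differential calculus come from the sup norm, hence coincide with the
   Euclidean ones; balls, however, are metric objects and use enorm below. *)

Section euclidean.
Context {R : realType}.

Definition enorm d (v : 'rV[R]_d) : R := Num.sqrt (\sum_i v ord0 i ^+ 2).

Definition eball d (x : 'rV[R]_d) (r : R) : set 'rV[R]_d :=
  [set y | enorm (y - x) < r].

End euclidean.

(* Lebesgue outer measure: infimum of the total volume of a countable cover by
   closed nonempty boxes.  The measurable subsets of R^d are those that are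
   Lebesgue (i.e., Caratheodory) measurable, not only the Borel ones. *)
Section lebesgue_outer_measure.
Context {R : realType} {n : nat}.
Local Notation Rd := 'rV[R]_n.+1.
Local Open Scope ereal_scope.

Definition cbox (ab : Rd * Rd) : set Rd :=
  [set x | forall i, (ab.1 ord0 i <= x ord0 i <= ab.2 ord0 i)%R].

Definition cbox_vol (ab : Rd * Rd) : \bar R :=
  (\prod_i (ab.2 ord0 i - ab.1 ord0 i))%:E.

Definition box_cover (A : set Rd) : set (nat -> Rd * Rd) :=
  [set F : nat -> Rd * Rd | (forall k i, ((F k).1 ord0 i <= (F k).2 ord0 i)%R) /\
           A `<=` \bigcup_k cbox (F k)].

Definition lebesgue_outer (A : set Rd) : \bar R :=
  ereal_inf [set \sum_(k <oo) cbox_vol (F k) | F in box_cover A].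

Let vol_ge0 A F k : box_cover A F -> 0 <= cbox_vol (F k).
Proof.
by move=> [F0 _]; rewrite lee_fin; apply: prodr_ge0 => i _; rewrite subr_ge0.
Qed.

Let lebesgue_outer_ge0 A : 0 <= lebesgue_outer A.
Proof.
apply: le_ereal_inf_tmp => _ [F FA <-].
by apply: nneseries_ge0 => k _ _; exact: vol_ge0 FA.
Qed.

Let lebesgue_outer0 : lebesgue_outer set0 = 0.
Proof.
apply/eqP; rewrite eq_le lebesgue_outer_ge0 andbT.
apply: ereal_inf_lbound; exists (fun=> (0%R, 0%R)).
  by split=> [k i|//]; rewrite lexx.
rewrite eseries0// => k _ _; rewrite /cbox_vol/= (bigD1 ord0)//=.
by rewrite subrr mul0r.
Qed.

Let le_lebesgue_outer : {homo lebesgue_outer : A B / A `<=` B >-> A <= B}.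
Proof.
move=> A B AB; apply/ereal_inf_le_tmp => _ [F [F0 BF] <-].
by exists F => //; split => //; exact: subset_trans BF.
Qed.

Let lebesgue_outer_sigma_subadditive : sigma_subadditive lebesgue_outer.
Proof.
move=> A; have [[i ioo]|] := pselect (exists i, lebesgue_outer (A i) = +oo).
  rewrite (eseries_pinfty _ _ ioo) ?leey// => k _.
  by rewrite -ltNye (lt_le_trans _ (lebesgue_outer_ge0 _)).
rewrite -forallNE => Aoo.
suff add2e (e : {posnum R}) : lebesgue_outer (\bigcup_k A k) <=
    \sum_(i <oo) lebesgue_outer (A i) + e%:num%:E.
  by apply/lee_addgt0Pr => _/posnumP[].
rewrite (le_trans _ (epsilon_trick _ _ _))//.
pose P k (B : nat -> Rd * Rd) := box_cover (A k) B /\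
  \sum_(j <oo) cbox_vol (B j) <=
    lebesgue_outer (A k) + (e%:num / (2 ^ k.+1)%:R)%:E.
have [G PG] : {G : nat -> nat -> Rd * Rd & forall k, P k (G k)}.
  apply: (@choice _ _ P) => k; rewrite /P.
  have Afin : lebesgue_outer (A k) \is a fin_num.
    by rewrite ge0_fin_numE// lt_neqAle leey andbT; apply/eqP.
  have ek : (0 < e%:num / (2 ^ k.+1)%:R)%R by [].
  have [_ [B AB <-] /ltW BA] := lb_ereal_inf_adherent ek Afin.
  by exists B.
have volG_ge0 i j : 0 <= cbox_vol (G i j) by exact: vol_ge0 (PG i).1.
apply: (@le_trans _ _ (\esum_(i in setT) (cbox_vol \o uncurry G) i)).
  apply: ereal_inf_lbound => /=.
  have /card_esym/ppcard_eqP[f] := card_nat2.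
  exists (uncurry G \o f).
    split => [k i|].
      by rewrite /=; case: (f k) => a b /=; exact: ((PG a).1.1 b i).
    move=> t [i _ Ait]; have [j _ Gt] := (PG i).1.2 _ Ait.
    by exists (f^-1%FUN (i, j)) => //=; rewrite invK ?inE.
  rewrite -(esum_pred_image (cbox_vol \o uncurry G) _ xpredT) ?[fun=> _]set_true//.
    by rewrite image_eq.
  by move=> k _ /=; case: (f k) => a b /=; exact: volG_ge0.
rewrite (_ : esum _ _ = \sum_(i <oo) \sum_(j <oo) cbox_vol (G i j)); last first.
  pose J : nat -> set (nat * nat) := fun i => [set (i, j) | j in setT].
  rewrite (_ : setT = \bigcup_k J k); last first.
    by rewrite predeqE => -[a b]; split => // _; exists a => //; exists b.
  rewrite esum_bigcupT /=; last 2 first.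
    - apply/trivIsetP => i j _ _ ij.
      rewrite predeqE => -[a b] /=; split => //= -[] [_] _ [<-{a} _].
      by move=> [m' _] [] /esym/eqP; rewrite (negbTE ij).
    - by move=> /= [a b] /=; exact: volG_ge0.
  rewrite -(image_id [set: nat]) -fun_true esum_pred_image//; last first.
    by move=> k _; apply: esum_ge0 => -[a b] _ /=; exact: volG_ge0.
  apply: eq_eseriesr => /= j _.
  rewrite -(esum_pred_image (cbox_vol \o uncurry G) (pair j) predT)//=; last first.
    by move=> ? ? _ _; exact: (@can_inj _ _ _ snd).
  by congr (esum _ _); rewrite predeqE => -[a b]; split; move=> [i _ <-]; exists i.
apply: lee_nneseries => [k _ _|k _].
  by apply: nneseries_ge0 => j _ _; exact: volG_ge0.
exact: (PG k).2.
Qed.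

HB.instance Definition _ := isOuterMeasure.Build R Rd lebesgue_outer
  lebesgue_outer0 lebesgue_outer_ge0 le_lebesgue_outer
  lebesgue_outer_sigma_subadditive.

End lebesgue_outer_measure.

HB.instance Definition _ (R : realType) (n : nat) :=
  Measurable.copy 'rV[R]_n.+1 (caratheodory_type (@lebesgue_outer R n)).

Section lebesgue.
Context (R : realType) (n : nat).

Definition lebesgue : set 'rV[R]_n.+1 -> \bar R := lebesgue_outer.

HB.instance Definition _ := isMeasure.Build _ _ _ lebesgue
  (caratheodory_measure0 (@lebesgue_outer R n))
  (@caratheodory_measure_ge0 _ _ (@lebesgue_outer R n))
  (@caratheodory_measure_sigma_additive _ _ (@lebesgue_outer R n)).

End lebesgue.
Arguments lebesgue {R n}.

Section bv.
Context {R : realType} {n : nat}.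
Local Notation Rd := 'rV[R]_n.+1.
Implicit Types (Omega D : set Rd) (u : Rd -> R) (phi : Rd -> Rd).

Definition ess_sup_on D (f : Rd -> \bar R) : \bar R :=
  ereal_inf [set y | \forall x \ae lebesgue, D x -> (f x <= y)%E].

Definition ess_inf_on D (f : Rd -> \bar R) : \bar R :=
  ereal_sup [set y | \forall x \ae lebesgue, D x -> (y <= f x)%E].

Definition ebasis (i : 'I_n.+1) : Rd := delta_mx ord0 i.

Definition continuously_differentiable phi :=
  forall i, (forall x, derivable phi x (ebasis i)) /\
            continuous ('D_(ebasis i) phi).

Definition divergence phi (x : Rd) : R := \sum_i ('D_(ebasis i) phi x) ord0 i.

Definition supp phi : set Rd := closure [set x | phi x != 0].

(* C^1_c(Omega; R^d) vector fields of Euclidean norm at most 1 *)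
Definition test_fields Omega : set (Rd -> Rd) :=
  [set phi | [/\ continuously_differentiable phi,
                 compact (supp phi),
                 supp phi `<=` Omega &
                 forall x, enorm (phi x) <= 1]].

Definition variation Omega u : \bar R :=
  ereal_sup [set (\int[lebesgue]_(x in Omega) (u x * divergence phi x)%:E)%E
            | phi in test_fields Omega].

Definition BV Omega u :=
  lebesgue.-integrable Omega (EFin \o u) /\ (variation Omega u < +oo)%E.

Definition Linfty Omega u :=
  measurable_fun Omega u /\ (ess_sup_on Omega (fun x => `|u x|%:E) < +oo)%E.

Definition finite_perimeter Omega (A : set Rd) := BV Omega (\1_A).

(* Near each boundary point, after an orthogonal change of coordinates
   y |-> y *m Q, Omega is the strict epigraph of a Lipschitz function of the
   first d - 1 coordinates.  No connectedness is required. *)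
Definition lipschitz_domain Omega :=
  forall x, (closure Omega `\` Omega°) x ->
  exists r (Q : 'M[R]_n.+1) (g : 'rV[R]_n -> R),
    [/\ 0 < r, Q *m Q^T = 1%:M, lipschitz g &
        Omega `&` eball x r =
        [set y | g (col' ord_max (y *m Q)) < (y *m Q) ord0 ord_max]
          `&` eball x r].

Definition Per Omega (rho0 rho1 : Rd -> R) (eps : R) (A : set Rd) : \bar R :=
  let chi x := (\1_A x : R)%:E in
  (eps^-1%:E * \int[lebesgue]_(x in Omega)
      ((ess_sup_on (eball x eps `&` Omega) chi - chi x) * (rho0 x)%:E) +
   eps^-1%:E * \int[lebesgue]_(x in Omega)
      ((chi x - ess_inf_on (eball x eps `&` Omega) chi) * (rho1 x)%:E))%E.

End bv.

(* Main.v *)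
Require Import Defs.
From mathcomp Require Import all_boot all_order all_algebra.
From mathcomp Require Import all_classical all_reals all_analysis.
From mathcomp Require Import measurable_realfun.
From mathcomp Require Import ring lra zify.

Import Order.TTheory GRing.Theory Num.Theory.
Import numFieldNormedType.Exports.

Set Implicit Arguments.
Unset Strict Implicit.
Unset Printing Implicit Defensive.

Local Open Scope classical_set_scope.
Local Open Scope ring_scope.

(** The perimeter bounds the effect of translations on the sets, and the theorem
    then is a version of the Kolmogorov-Riesz compactness criterion for indicators.

    Translations. Suppose that [Per] is at most [M] for [A] and [eps], let
    [0 < t < eps], and consider the points [x] outside [A], not too close to the
    boundary of [Omega], such that [y := x + t *: ebasis i] belongs to [A]. Almost
    every such [x] sees [A] with positive measure in the ball of radius [eps], so it
    contributes to the first term of the perimeter; in the same way, [y] sees the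
    complement of [A] and contributes to the second one. Hence the integral of
    [rho0] over the points [x], and that of [rho1] over the points [y], are at most
    [eps * M] ([Per_layers]). The two sets are translates of each other by
    [t *: ebasis i], so the integrals of [rho1] over them differ by at most [t] times
    the variation of [rho1] ([variation_set_shift]). The integral of [rho0 + rho1] over
    the points [x] is therefore of order [eps], and a lower bound of [rho0 + rho1]
    turns this into a bound on their measure. With the symmetric argument for the
    points leaving [A], this is [Per_axis_shift]. Chaining such translations yields
    a constant [C], the same for all the sets of the sequence, with
    [mu (A `+` axis_shift A i t) <= C * (|t| + eps)] far enough from the boundary,
    for [t] of any size ([small_shifts_bound]).

    Compactness. A measurable set is nearly a union of cells of a very fine grid.
    If [N] consecutive cells are merged, by copying one of their columns onto the
    others, then the error grows by translations of [A] along at most [N] cells,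
    and a good choice of the column makes this growth no larger than its mean
    ([merge_columns]). Merging in all directions replaces [A] by a union of cells
    of a prescribed size [L], up to an error of order [L + eps]
    ([grid_approximation]). There are finitely many such unions inside [Omega], so
    they can be made constant along a subsequence, for all [L] in a sequence
    tending to [0]. The sets of that subsequence have summable successive
    differences, and converge ([set_compactness]).

    Perimeter of the limit. In the limit, [mu (B `+` axis_shift B i t) <= C * |t|]
    ([shift_bound_limit]). The difference quotients of the integral of a test
    function over the translates of [B] are thus bounded by [C], and so is the
    integral over [B] of its partial derivative ([shift_bound_finite_perimeter]). *)

(** * Half-spaces are measurable *)

Section measure_of_boxes.
Context {R : realType} {n : nat}.
Local Notation Rd := 'rV[R]_n.+1.
Local Notation mu := (@lebesgue R n).
Implicit Types (x v : Rd) (i : 'I_n.+1) (c : R).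

Definition set_coord v i c : Rd := \row_j (if j == i then c else v ord0 j).

(** A hyperplane cuts a box into two boxes whose volumes add up, so a cover of
    [X] yields covers of both parts of [X] of the same total volume. *)
Lemma measurable_coord_le i c : measurable [set x : Rd | x ord0 i <= c].
Proof.
apply: le_caratheodory_measurable => X; set H := [set x | _].
apply: le_ereal_inf_tmp => _ [F [F0 XF] <-].
(* The outer clampings keep the pieces nonempty, of volume 0, when the hyperplane
   misses the box. *)
pose F1 k := ((F k).1, set_coord (F k).2 i
  (Num.max ((F k).1 ord0 i) (Num.min ((F k).2 ord0 i) c))).
pose F2 k := (set_coord (F k).1 i
  (Num.min ((F k).2 ord0 i) (Num.max ((F k).1 ord0 i) c)), (F k).2).
have F1c : box_cover (X `&` H) F1.
  split=> [k j|x [Xx Hx]].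
    rewrite /F1 /= mxE; case: eqP => [->|_]; last exact: F0.
    by rewrite le_max lexx.
  have [k _ Fk] := XF _ Xx; exists k => // j; have /andP[a b] := Fk j.
  rewrite /F1 /= mxE a /=; case: eqP => [ji|//].
  by rewrite -ji le_max le_min b -/H ji Hx orbT.
have F2c : box_cover (X `&` ~` H) F2.
  split=> [k j|x [Xx Hx]].
    rewrite /F2 /= mxE; case: eqP => [->|_]; last exact: F0.
    by rewrite ge_min lexx.
  have [k _ Fk] := XF _ Xx; exists k => // j; have /andP[a b] := Fk j.
  rewrite /F2 /= mxE b andbT; case: eqP => [ji|//].
  have : c < x ord0 i by move/negP: Hx; rewrite /= -ltNge.
  by move=> /ltW cx; rewrite ge_min ge_max -ji a ji cx orbT.
apply: (@le_trans _ _ (\sum_(k <oo) cbox_vol (F1 k) +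
                      \sum_(k <oo) cbox_vol (F2 k))%E).
  by apply: leeD; apply: ereal_inf_lbound; [exists F1|exists F2].
have vol0 G A k : box_cover A G -> (0 <= cbox_vol (G k))%E.
  by move=> [G0 _]; rewrite lee_fin; apply: prodr_ge0 => j _; rewrite subr_ge0.
rewrite -nneseriesD; [|by move=> k _ _; exact: vol0 F1c|by move=> k _ _; exact: vol0 F2c].
rewrite le_eqVlt; apply/orP; left; apply/eqP; apply: eq_eseriesr => k _.
rewrite /cbox_vol /= -EFinD; congr EFin.
rewrite (bigD1 i)//= [X in _ + X](bigD1 i)//= [RHS](bigD1 i)//= !mxE !eqxx.
rewrite (eq_bigr (fun j => (F k).2 ord0 j - (F k).1 ord0 j)); last first.
  by move=> j /negbTE ji; rewrite mxE ji.
rewrite [X in _ + _ * X](eq_bigr (fun j => (F k).2 ord0 j - (F k).1 ord0 j)); last first.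
  by move=> j /negbTE ji; rewrite mxE ji.
rewrite -mulrDl; congr (_ * _).
have := F0 k i; move: ((F k).1 ord0 i) ((F k).2 ord0 i) => a b ab.
case: (leP b c) => bc.
  by rewrite (max_r ab) min_l ?subrr ?addr0// le_max bc orbT.
case: (leP a c) => ac; first by rewrite (min_r (ltW bc)); ring.
by rewrite (min_r ab); ring.
Qed.
End measure_of_boxes.

(** * Open sets and continuous functions are measurable *)

Section open_sets.
Context {R : realType} {n : nat}.
Local Notation Rd := 'rV[R]_n.+1.
Local Notation mu := (@lebesgue R n).
Implicit Types (x y v : Rd) (i : 'I_n.+1) (e r : R) (U : set Rd).

Lemma ball_coordP x e y :
  ball x e y <-> 0 < e /\ forall i, `|x ord0 i - y ord0 i| < e.
Proof.
split=> [[e0 xy]|[e0 xy]]; first by split=> // i; exact: xy.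
by split=> // i j; rewrite ord1; exact: xy.
Qed.

Lemma coord_le_enorm x i : `|x ord0 i| <= enorm x.
Proof.
rewrite -(sqrtr_sqr (x ord0 i)) ler_sqrt; last by apply: sumr_ge0 => j _; exact: sqr_ge0.
by rewrite (bigD1 i)//= lerDl; apply: sumr_ge0 => j _; exact: sqr_ge0.
Qed.

Lemma rat_dense x e : 0 < e ->
  exists q : 'rV[rat]_n.+1, forall i, `|ratr (q ord0 i) - x ord0 i| < e.
Proof.
move=> e0; have /choice[q qP] : forall i, exists q : rat, `|ratr q - x ord0 i| < e.
  move=> i; have : x ord0 i - e < x ord0 i + e by lra.
  by move=> /rat_in_itvoo[q]; rewrite in_itv/= => /andP[q1 q2]; exists q; rewrite ltr_distl q1 q2.
by exists (\row_i q i) => i; rewrite mxE.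
Qed.

Definition rat_ball (p : 'rV[rat]_n.+1 * nat) : set Rd :=
  ball (map_mx ratr p.1 : Rd) p.2.+1%:R^-1.

Lemma rat_ball_basis x e : 0 < e -> exists p, rat_ball p x /\ rat_ball p `<=` ball x e.
Proof.
move=> e0; have [m me] : exists m, m.+1%:R^-1 < e / 2.
  have e2 : 0 < e / 2 by lra.
  have := near_infty_natSinv_lt (PosNum e2) => -[m _ /(_ m)]/= H; exists m; exact: H.
have m0 : 0 < m.+1%:R^-1 :> R by rewrite invr_gt0.
have [q qx] := rat_dense x m0; exists (q, m).
have qxi i : `|(map_mx ratr q : Rd) ord0 i - x ord0 i| < m.+1%:R^-1 by rewrite mxE.
split=> [|y /ball_coordP[_ qy]]; apply/ball_coordP; split=> // i.
rewrite (_ : _ - _ = - ((map_mx ratr q : Rd) ord0 i - x ord0 i) +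
   ((map_mx ratr q : Rd) ord0 i - y ord0 i)); last by ring.
rewrite (le_lt_trans (ler_normD _ _))// normrN.
by have := qxi i; have := qy i; move: me; rewrite /=; move: (_^-1) => d ? ? ?; lra.
Qed.

(** Only closed half-spaces are measurable so far, which is why each strict
    inequality on the right is written as a countable union of large ones. *)
Lemma measurable_ball x e : measurable (ball x e : set Rd).
Proof.
have [e0|e0] := ltP 0 e; last first.
  rewrite (_ : ball x e = set0) //; apply/seteqP; split=> // y /ball_coordP[].
  by rewrite ltNge e0.
have -> : ball x e = \bigcap_(i in [set: 'I_n.+1])
    (~` [set y | y ord0 i <= x ord0 i - e] `&` \bigcup_k [set y | y ord0 i <= x ord0 i + e - k.+1%:R^-1]).
  apply/seteqP; split=> [y /ball_coordP[_ xy] i _|y xy].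
    have := xy i; rewrite ltr_norml => /andP[h1 h2]; split.
      by apply/negP; rewrite -ltNge; lra.
    have e2 : 0 < x ord0 i + e - y ord0 i by lra.
    have := near_infty_natSinv_lt (PosNum e2) => -[m _ /(_ m)/= H].
    by exists m => //=; have := H (leqnn m); move: (_^-1) => d ?; lra.
  apply/ball_coordP; split=> // i; have [/negP + [k _ /=]] := xy i I.
  rewrite -ltNge => h1 h2; have : (0 : R) < k.+1%:R^-1 by rewrite invr_gt0.
  by rewrite ltr_norml; move: h1 h2; move: (_^-1) => d ? ? ?; apply/andP; split; lra.
apply: fin_bigcap_measurable => // i _; apply: measurableI.
  by apply: measurableC; exact: measurable_coord_le.
by apply: bigcupT_measurable => k; exact: measurable_coord_le.
Qed.

Lemma open_bigcup_rat_ball U : open U ->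
  U = \bigcup_(p in [set p | rat_ball p `<=` U]) rat_ball p.
Proof.
move=> oU; apply/seteqP; split=> [x Ux|x [p /= pU px]]; last exact: pU.
have /nbhs_ballP[e /= e0 eU] : nbhs x U by exact: open_nbhs_nbhs.
have [p [px pe]] := rat_ball_basis x e0; exists p => //=.
exact: subset_trans eU.
Qed.

Lemma open_measurable_Rd U : open U -> measurable U.
Proof.
move=> oU; rewrite (open_bigcup_rat_ball oU).
rewrite bigcup_mkcond; apply: countable_bigcupT_measurable => // p.
by case: ifP => // _; exact: measurable_ball.
Qed.

Lemma closed_measurable_Rd U : closed U -> measurable U.
Proof. by move=> cU; rewrite -(setCK U); apply/measurableC/open_measurable_Rd/closed_openC. Qed.

Lemma continuous_measurable_Rd (f : Rd -> R) : continuous f -> measurable_fun setT f.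
Proof.
move=> cf _; apply: (measurability _ (RGenOInfty.measurableE R)) => // _ [_ [a ->] <-].
rewrite setTI; apply: open_measurable_Rd.
by apply: open_comp => [x _|]; [exact: cf|exact: rray_open].
Qed.

End open_sets.

(** * Translation invariance of Lebesgue measure *)

Section translation.
Context {R : realType} {n : nat}.
Local Notation Rd := 'rV[R]_n.+1.
Local Notation mu := (@lebesgue R n).
Implicit Types (x y v : Rd) (i : 'I_n.+1) (e r : R) (A U : set Rd).

Definition translate v A : set Rd := [set x | A (x + v)].

Lemma translateK v A : translate (- v) (translate v A) = A.
Proof. by apply/seteqP; split=> x; rewrite /translate /= subrK. Qed.

Let le_outer_translate v A : (mu A <= mu (translate v A))%E.
Proof.
apply: le_ereal_inf_tmp => _ [F [F0 AF] <-].
apply: ereal_inf_lbound; exists (fun k => ((F k).1 + v, (F k).2 + v)).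
  split=> [k i|x Ax]; first by rewrite !mxE lerD2r.
  have [|k _ Fk] := AF (x - v); first by rewrite /translate /= subrK.
  exists k => // i; have := Fk i; rewrite !mxE /= => /andP[h1 h2].
  by apply/andP; split; lra.
apply: eq_eseriesr => k _; congr EFin; apply: eq_bigr => i _.
by rewrite /= !mxE; ring.
Qed.

(** Translating the boxes of a cover does not change their volumes. *)
Lemma lebesgue_translate v A : mu (translate v A) = mu A.
Proof.
apply/eqP; rewrite eq_le le_outer_translate andbT.
by have := le_outer_translate (- v) (translate v A); rewrite translateK.
Qed.

Lemma measurable_translate v A : measurable A -> measurable (translate v A).
Proof.
move=> mA; apply: le_caratheodory_measurable => X.
have -> : X = translate v (translate (- v) X) by have := translateK (- v) X; rewrite opprK.
move: (translate _ X) => {}X; have /= := mA X.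
have := lebesgue_translate v; rewrite /lebesgue => H.
by rewrite H -(H (X `&` A)) -(H (X `&` ~` A)) => ->.
Qed.

Lemma measurable_fun_addr v : measurable_fun setT (fun x : Rd => x + v).
Proof. by move=> _ A mA; rewrite setTI; exact: measurable_translate. Qed.

Let pushforward_translate v : pushforward mu (fun x : Rd => x + v) = mu.
Proof. by apply: funext => A; exact: (lebesgue_translate v A). Qed.

Lemma ge0_integral_translate v A (f : Rd -> \bar R) : measurable A ->
  measurable_fun A f -> (forall x, A x -> (0 <= f x)%E) ->
  (\int[mu]_(x in translate v A) f ((x : Rd) + v)%R = \int[mu]_(x in A) f x)%E.
Proof.
move=> mA mf f0.
rewrite -(ge0_integral_pushforward (measurable_fun_addr v))//; last first.
  by move=> x; rewrite inE; exact: f0.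
by rewrite pushforward_translate.
Qed.

Lemma integral_translate v A (f : Rd -> \bar R) : measurable A ->
  measurable_fun setT f -> mu.-integrable A f ->
  (\int[mu]_(x in translate v A) f ((x : Rd) + v)%R = \int[mu]_(x in A) f x)%E.
Proof.
move=> mA mf /integrableP[_ intf].
rewrite -(integral_pushforward (measurable_fun_addr v))//.
  by rewrite pushforward_translate.
apply/integrableP; split.
  exact: (measurable_funTS (measurableT_comp mf (measurable_fun_addr v))).
rewrite (ge0_integral_translate v (f := fun x => `|f x|%E))//.
by apply: measurableT_comp => //; exact: measurable_funTS.
Qed.

End translation.

(** * Regularity of Lebesgue measure *)

Section regularity.
Context {R : realType} {n : nat}.
Local Notation Rd := 'rV[R]_n.+1.
Local Notation mu := (@lebesgue R n).
Implicit Types (x y v : Rd) (i : 'I_n.+1) (e r : R) (A U : set Rd).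
Local Open Scope ereal_scope.

Lemma lebesgue_cbox_le (ab : Rd * Rd) :
  (forall i, ab.1 ord0 i <= ab.2 ord0 i)%R -> mu (cbox ab) <= cbox_vol ab.
Proof.
move=> ab0; pose F (k : nat) : Rd * Rd := if k is 0%N then ab else (0%R, 0%R).
apply: (@le_trans _ _ (\sum_(k <oo) cbox_vol (F k))).
  apply: ereal_inf_lbound; exists F => //; split => [[|k] i//=|x abx].
  by exists 0%N.
rewrite (nneseries_split _ 1) => [|[|k] _ /=]; last 2 first.
- by rewrite lee_fin; apply: prodr_ge0 => i _; rewrite subr_ge0.
- by rewrite lee_fin; apply: prodr_ge0 => i _; rewrite subr_ge0 /=.
rewrite add0n big_nat1 eseries0 ?adde0// => -[//|k] _ _.
by rewrite /cbox_vol/= (bigD1 ord0)//= subrr mul0r.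
Qed.

Lemma bounded_cbox A : bounded_set A -> exists ab : Rd * Rd,
  (forall i, ab.1 ord0 i <= ab.2 ord0 i)%R /\ A `<=` cbox ab.
Proof.
move=> [M [Mreal normAltM]].
exists (const_mx (- (`|M| + 1))%R, const_mx (`|M| + 1)%R); split=> [i|x Ax i].
  by rewrite !mxE ge0_cp.
rewrite !mxE -ler_norml.
have /(normAltM _)/(_ x Ax) Mx : (M < `|M| + 1)%R.
  by rewrite (le_lt_trans (ler_norm _))// ltrDl.
apply: le_trans Mx; rewrite [leRHS]/Num.norm /= mx_normrE.
by apply/bigmax_geP; right => /=; exists (ord0, i).
Qed.

Lemma bounded_lebesgue_lty A : bounded_set A -> mu A < +oo.
Proof.
move=> /bounded_cbox[ab [ab0 Aab]]; apply: (@le_lt_trans _ _ (cbox_vol ab)).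
  by apply: le_trans (lebesgue_cbox_le ab0); exact: le_outer_measure.
by rewrite ltry.
Qed.

Lemma open_coord (D : set R) i : open D -> open [set x : Rd | D (x ord0 i)].
Proof.
by move=> oD; apply: (open_comp (f := fun x : Rd => x ord0 i)) oD => x _; exact: coord_continuous.
Qed.

Lemma closed_coord (D : set R) i : closed D -> closed [set x : Rd | D (x ord0 i)].
Proof.
by move=> oD; apply: (closed_comp (f := fun x : Rd => x ord0 i)) oD => x _; exact: coord_continuous.
Qed.

Definition obox (ab : Rd * Rd) (s : R) : set Rd :=
  [set x | forall i, (ab.1 ord0 i - s < x ord0 i < ab.2 ord0 i + s)%R].

Lemma open_obox ab s : open (obox ab s).
Proof.
have -> : obox ab s = ~` \bigcup_(i in [set: 'I_n.+1])
   ~` ([set x : Rd | ab.1 ord0 i - s < x ord0 i]%R `&` [set x | x ord0 i < ab.2 ord0 i + s]%R).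
  rewrite setC_bigcup; under eq_bigcapr do rewrite setCK.
  apply/seteqP; split=> [x h i _|x h i]; first by have /andP := h i.
  by have [h1 h2] := h i I; apply/andP.
apply: closed_openC; apply: closed_bigcup => [|i _]; first exact: finite_finset.
apply: open_closedC; apply: openI.
  by apply: (@open_coord [set y | ab.1 ord0 i - s < y]%R i); exact: open_gt.
by apply: (@open_coord [set y | y < ab.2 ord0 i + s]%R i); exact: open_lt.
Qed.

(** The volume of the box enlarged by [s] on all sides is polynomial in [s]. *)
Lemma cbox_vol_cont (ab : Rd * Rd) e : (0 < e)%R ->
  (forall i, ab.1 ord0 i <= ab.2 ord0 i)%R ->
  exists s, (0 < s)%R /\ mu (obox ab s) <= cbox_vol ab + e%:E.
Proof.
move=> e0 ab0.
pose V (s : R) : R := (\prod_i (ab.2 ord0 i + s - (ab.1 ord0 i - s)))%R.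
have Vc : continuous V.
  apply: continuous_big => [xy|i _ s].
    by apply: cvgM; [exact: cvg_fst|exact: cvg_snd].
  apply: cvgB; first by apply: cvgD; [exact: cvg_cst|exact: cvg_id].
  by apply: cvgB; [exact: cvg_cst|exact: cvg_id].
have : \forall s \near (0:R)^'+, (V s < V 0 + e)%R.
  have VV : \forall s \near (0%R:R), (V s < V 0 + e)%R.
    by apply: (@cvgr_lt _ _ _ _ V (V 0%R) (Vc 0%R)); rewrite ltrDl.
  by apply: cvg_within; exact: VV.
move=> VV; near (0:R)^'+ => s; exists s; split => //.
have ab1 i : (ab.1 ord0 i - s <= ab.2 ord0 i + s)%R.
  by rewrite lerBlDr -addrA ler_wpDr// addr_ge0// ltW.
pose ab' : Rd * Rd := (\row_i (ab.1 ord0 i - s)%R, \row_i (ab.2 ord0 i + s)%R).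
apply: (@le_trans _ _ (mu (cbox ab'))).
  apply: le_outer_measure => x abx i; rewrite !mxE.
  by have /andP[/ltW -> /ltW ->] := abx i.
apply: le_trans (lebesgue_cbox_le _) _ => [i|]; first by rewrite !mxE.
rewrite /cbox_vol -EFinD lee_fin.
under eq_bigr do rewrite !mxE.
have -> : (\prod_i (ab.2 ord0 i - ab.1 ord0 i) = V 0)%R.
  by apply: eq_bigr => i _; rewrite addr0 subr0.
by apply/ltW; near: s.
Unshelve. all: by end_near. Qed.

(** The boxes of a nearly optimal cover are made open at a cost that is summable
    in the index of the box. *)
Lemma lebesgue_outer_regular A e : (0 < e)%R -> mu A < +oo ->
  exists U, [/\ open U, A `<=` U & mu U <= mu A + e%:E].
Proof.
move=> e0 Aoo.
have e2 : (0 < e / 2)%R by rewrite divr_gt0.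
have Afin : mu A \is a fin_num by rewrite ge0_fin_numE.
have [_ [F [F0 AF] <-] /ltW FA] := lb_ereal_inf_adherent e2 Afin.
have /choice[s sP] : forall k, exists s, (0 < s)%R /\
    mu (obox (F k) s) <= cbox_vol (F k) + (e / 2 / (2 ^ k.+1)%:R)%:E.
  by move=> k; apply: cbox_vol_cont => //; rewrite divr_gt0// ltr0n expn_gt0.
exists (\bigcup_k obox (F k) (s k)); split.
- by apply: bigcup_open => k _; exact: open_obox.
- move=> x /AF[k _ Fk]; exists k => // i; have /andP[h1 h2] := Fk i.
  by have [s0 _] := sP k; apply/andP; split; lra.
- have -> : mu A + e%:E = mu A + (e / 2)%:E + (e / 2)%:E.
    by rewrite -addeA -EFinD -splitr.
  apply: (@le_trans _ _ (\sum_(k <oo) cbox_vol (F k) + (e / 2)%:E)); last exact: leeD2r.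
  apply: le_trans (epsilon_trick _ _ _); last 2 first.
  + by move=> k; rewrite lee_fin; apply: prodr_ge0 => i _; rewrite subr_ge0.
  + exact: ltW.
  apply: (le_trans (outer_measure_sigma_subadditive _ _)).
  by apply: lee_nneseries => // k _; have [] := sP k.
Qed.

Lemma closed_cbox (ab : Rd * Rd) : closed (cbox ab).
Proof.
have -> : cbox ab = \bigcap_(i in [set: 'I_n.+1])
   ([set x : Rd | ab.1 ord0 i <= x ord0 i]%R `&` [set x | x ord0 i <= ab.2 ord0 i]%R).
  apply/seteqP; split=> [x h i _|x h i]; first by have /andP := h i.
  by have [h1 h2] := h i I; apply/andP.
apply: closed_bigI => i _; apply: closedI.
  by apply: (@closed_coord [set y | ab.1 ord0 i <= y]%R i); exact: closed_ge.
by apply: (@closed_coord [set y | y <= ab.2 ord0 i]%R i); exact: closed_le.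
Qed.

(** Outer regularity is applied to the complement of [A] in a box containing [A]. *)
Lemma lebesgue_inner_regular A e : (0 < e)%R -> measurable A -> bounded_set A ->
  exists K, [/\ closed K, K `<=` A & mu (A `\` K) <= e%:E].
Proof.
move=> e0 mA bA; have [ab [ab0 Aab]] := bounded_cbox bA.
have mB : measurable (cbox ab) by apply: closed_measurable_Rd; exact: closed_cbox.
have Boo : mu (cbox ab) < +oo.
  by apply: le_lt_trans (lebesgue_cbox_le ab0) _; rewrite ltry.
have BAoo : mu (cbox ab `\` A) < +oo.
  by apply: le_lt_trans Boo; apply: le_outer_measure; exact: subDsetl.
have [U [oU BAU UBA]] := lebesgue_outer_regular e0 BAoo.
have mU := open_measurable_Rd oU.
exists (cbox ab `\` U); split.
- by apply: closedI; [exact: closed_cbox|exact: open_closedC].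
- by move=> x [abx Ux]; apply: contrapT => Ax; apply: Ux; apply: BAU.
- have mBA : measurable (cbox ab `\` A) by exact: measurableD.
  apply: (@le_trans _ _ (mu (U `\` (cbox ab `\` A)))).
    apply: le_outer_measure => x [Ax nK]; split; last by move=> [].
    by apply: contrapT => nU; apply: nK; split => //; exact: Aab.
  rewrite measureD//; last by rewrite (le_lt_trans UBA)// lte_add_pinfty// ltry.
  by rewrite (setIidr BAU) leeBlDl// ge0_fin_numE.
Qed.

End regularity.

(** * Null sets and points of positive local measure *)

Section null_sets.
Context {R : realType} {n : nat}.
Local Notation Rd := 'rV[R]_n.+1.
Local Notation mu := (@lebesgue R n).
Implicit Types (x y v : Rd) (i : 'I_n.+1) (e r : R) (A D U : set Rd).

Lemma lebesgue0_measurable A : mu A = 0%E -> measurable A.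
Proof.
move=> A0; apply: le_caratheodory_measurable => X.
have XA0 : mu (X `&` A) = 0%E.
  apply/eqP; rewrite eq_le measure_ge0 andbT -A0.
  by apply: le_outer_measure; exact: subIsetr.
apply: (@le_trans _ _ (mu (X `&` A) + mu (X `&` ~` A))%E); first exact: lexx.
by rewrite XA0 add0e; apply: le_outer_measure; exact: subIsetl.
Qed.

Lemma lebesgue0_negligible A : mu.-negligible A <-> mu A = 0%E.
Proof.
split=> [[N [mN N0 AN]]|A0]; last by exists A; split => //; exact: lebesgue0_measurable.
apply/eqP; rewrite eq_le measure_ge0 andbT -N0.
exact: le_outer_measure.
Qed.

Lemma sub_lebesgue0 A D : A `<=` D -> mu D = 0%E -> mu A = 0%E.
Proof.
move=> AD D0; apply/eqP; rewrite eq_le measure_ge0 andbT -D0.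
exact: le_outer_measure.
Qed.

Lemma setU_lebesgue0 A D : mu A = 0%E -> mu D = 0%E -> mu (A `|` D) = 0%E.
Proof.
move=> A0 D0; apply/lebesgue0_negligible; apply: negligibleU; exact/lebesgue0_negligible.
Qed.

Lemma lebesgue_bigcup0 (T : countType) (F : T -> set Rd) :
  (forall p, mu (F p) = 0%E) -> mu (\bigcup_p F p) = 0%E.
Proof.
move=> F0; pose G k : set Rd := if unpickle k is Some p then F p else set0.
have G0 k : mu (G k) = 0%E by rewrite /G; case: unpickle => //; exact: measure0.
apply/eqP; rewrite eq_le measure_ge0 andbT.
apply: (@le_trans _ _ (mu (\bigcup_k G k))).
  apply: le_outer_measure => x [p _ Fx]; exists (pickle p) => //.
  by rewrite /G pickleK.
apply: (le_trans (outer_measure_sigma_subadditive _ _)).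
by rewrite eseries0// => k _ _; exact: G0.
Qed.

(** Null sets are Caratheodory measurable, hence so is any modification on them. *)
Lemma ae_measurable_fun D (f g : Rd -> \bar R) : measurable D ->
  (\forall x \ae mu, D x -> f x = g x) -> measurable_fun D g -> measurable_fun D f.
Proof.
move=> mD [N [mN N0 fgN]] mg _ Y mY.
have -> : D `&` f @^-1` Y = ((D `&` g @^-1` Y) `\` N) `|` ((D `&` f @^-1` Y) `&` N).
  apply/seteqP; split=> x.
    move=> [Dx Yx]; have [Nx|Nx] := pselect (N x); first by right.
    left; split => //; split => //; rewrite /preimage /= -[g x](_ : f x = _) //.
    by apply: contrapT => fg; apply: Nx; apply: fgN => /= /(_ Dx).
  case=> [[[Dx Yx] Nx]|[]//]; split => //; rewrite /preimage /= (_ : f x = g x) //.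
  by apply: contrapT => fg; apply: Nx; apply: fgN => /= /(_ Dx).
apply: measurableU; first by apply: measurableD => //; exact: mg.
apply: lebesgue0_measurable; apply/eqP; rewrite eq_le measure_ge0 andbT -N0.
by apply: le_outer_measure; exact: subIsetr.
Qed.

(** A weak form of density points: essential suprema of indicators only test
    whether a measure vanishes, so no quantitative density is required. *)
Definition positive_part A : set Rd :=
  [set y | A y /\ forall r, 0 < r -> mu (ball y r `&` A) != 0%E].

(** An exceptional point lies in one of countably many rational balls that meet
    [A] in a null set. *)
Lemma positive_part_ae A : mu (A `\` positive_part A) = 0%E.
Proof.
pose F p : set Rd := if mu (rat_ball p `&` A) == 0%E then rat_ball p `&` A else set0.
have := @lebesgue_bigcup0 _ F; move=> H; apply/eqP; rewrite eq_le measure_ge0 andbT -H.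
  apply: le_outer_measure => y [Ay nA].
  have [r r0 /eqP Ar] : exists2 r, 0 < r & mu (ball y r `&` A) == 0%E.
    apply: contrapT => h; apply: nA; split => // r r0; apply/negP => Ar.
    by apply: h; exists r.
  have [p [py pr]] := rat_ball_basis y r0; exists p => //.
  rewrite /F; case: ifPn => [//|/eqP[]].
  apply/eqP; rewrite eq_le measure_ge0 andbT -Ar.
  by apply: le_outer_measure; exact: setSI.
by move=> p; rewrite /F; case: ifP => [/eqP//|_]; exact: measure0.
Qed.

Lemma eball_center x r : 0 < r -> eball x r x.
Proof.
move=> r0; rewrite /eball /= /enorm subrr big1 ?sqrtr0// => i _.
by rewrite mxE expr0n.
Qed.

Lemma enormB x y : enorm (x - y) = enorm (y - x).
Proof. by congr Num.sqrt; apply: eq_bigr => i _; rewrite -opprB mxE sqrrN. Qed.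

Lemma continuous_enormB x : continuous (fun y : Rd => enorm (y - x)).
Proof.
move=> y; apply: (@continuous_comp _ _ _ (fun y : Rd => \sum_i (y - x) ord0 i ^+ 2) Num.sqrt); last exact: sqrt_continuous.
move: y; apply: continuous_big => [|i _ y]; first exact: add_continuous.
apply: (@continuous_comp _ _ _ (fun y : Rd => (y - x) ord0 i) (fun z => z ^+ 2)).
  have -> : (fun y0 : Rd => (y0 - x) ord0 i) = (fun y0 => y0 ord0 i - x ord0 i).
    by apply: funext => z; rewrite !mxE.
  by apply: (@continuousB _ _ _ (fun z : Rd => z ord0 i) (cst (x ord0 i))); [exact: coord_continuous|exact: cst_continuous].
exact: exprn_continuous.
Qed.

Lemma open_eball x r : open (eball x r).
Proof.
apply: (@open_comp _ _ (fun y : Rd => enorm (y - x)) [set z | z < r]); last exact: open_lt.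
by move=> y _; exact: continuous_enormB.
Qed.

(** The points from which [A] is seen with positive measure at distance less than
    [r] form a union of balls, hence an open set: this makes the two layers below
    measurable. *)
Lemma eball_pos A x r : mu (eball x r `&` A) != 0%E <->
  (\bigcup_(y in positive_part A) eball y r) x.
Proof.
split=> [Ar|[y [Ay yA] yx]]; last first.
  have /nbhs_ballP[e /= e0 er] : nbhs y (eball x r).
    by apply: open_nbhs_nbhs; split; [exact: open_eball|rewrite /eball /= enormB].
  apply: contra (yA _ e0) => /eqP Ar; rewrite eq_le measure_ge0 andbT -Ar.
  by apply: le_outer_measure; exact: setSI.
apply: contrapT => nx; move/eqP: Ar; apply; apply/eqP.
rewrite eq_le measure_ge0 andbT -(positive_part_ae A).
apply: le_outer_measure => y [xy Ay]; split=> // pA; apply: nx.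
by exists y => //; rewrite /eball /= enormB.
Qed.

Lemma measurable_eball_pos A r : measurable [set x | mu (eball x r `&` A) != 0%E].
Proof.
have -> : [set x | mu (eball x r `&` A) != 0%E] = \bigcup_(y in positive_part A) eball y r.
  by apply/seteqP; split=> x /eball_pos.
by apply: open_measurable_Rd; apply: bigcup_open => y _; exact: open_eball.
Qed.

End null_sets.

(** * The nonlocal perimeter as an integral over two layers *)

Section perimeter.
Context {R : realType} {n : nat}.
Local Notation Rd := 'rV[R]_n.+1.
Local Notation mu := (@lebesgue R n).
Implicit Types (x y v : Rd) (i : 'I_n.+1) (e r : R) (A D U Omega : set Rd).
Local Open Scope ereal_scope.
Local Notation chi A := (fun x : Rd => (\1_A x : R)%:E).

Lemma chi1 A x : A x -> chi A x = 1.
Proof. by move=> Ax; rewrite /= indicE mem_set. Qed.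

Lemma chi0 A x : ~ A x -> chi A x = 0.
Proof. by move=> Ax; rewrite /= indicE memNset. Qed.

Lemma chi_ge0 A x : 0 <= chi A x.
Proof. by rewrite lee_fin indicE. Qed.

Lemma chi_le1 A x : chi A x <= 1.
Proof. by rewrite lee_fin indicE; case: (_ \in _). Qed.

Lemma ess_sup_chi1 A D : mu (D `&` A) != 0 -> ess_sup_on D (chi A) = 1.
Proof.
move=> DA; apply/eqP; rewrite eq_le; apply/andP; split.
  apply: ereal_inf_lbound; apply: aeW => x _; exact: chi_le1.
apply: le_ereal_inf_tmp => y /lebesgue0_negligible yae; rewrite leNgt; apply/negP => y1.
move/eqP: DA; apply; apply/eqP; rewrite eq_le measure_ge0 andbT -yae.
apply: le_outer_measure => x [Dx Ax] /(_ Dx); rewrite chi1//.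
by rewrite leNgt y1.
Qed.

Lemma ess_sup_chi0 A D : mu (D `&` A) = 0 -> mu (D `\` A) != 0 ->
  ess_sup_on D (chi A) = 0.
Proof.
move=> DA DnA; apply/eqP; rewrite eq_le; apply/andP; split.
  apply: ereal_inf_lbound; apply/lebesgue0_negligible.
  apply/eqP; rewrite eq_le measure_ge0 andbT -DA; apply: le_outer_measure => x /= nx.
  have [Dx|Dx] := pselect (D x); last by exfalso; apply: nx.
  split => //; apply: contrapT => Ax; apply: nx => _; by rewrite chi0.
apply: le_ereal_inf_tmp => y /lebesgue0_negligible yae; rewrite leNgt; apply/negP => y1.
move/eqP: DnA; apply; apply/eqP; rewrite eq_le measure_ge0 andbT -yae.
apply: le_outer_measure => x [Dx Ax] /(_ Dx); rewrite chi0//.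
by rewrite leNgt y1.
Qed.

Lemma ess_inf_chi0 A D : mu (D `\` A) != 0 -> ess_inf_on D (chi A) = 0.
Proof.
move=> DA; apply/eqP; rewrite eq_le; apply/andP; split; last first.
  apply: ereal_sup_ubound; apply: aeW => x _; exact: chi_ge0.
apply: ge_ereal_sup => y /lebesgue0_negligible yae; rewrite leNgt; apply/negP => y1.
move/eqP: DA; apply; apply/eqP; rewrite eq_le measure_ge0 andbT -yae.
apply: le_outer_measure => x [Dx Ax] /(_ Dx); rewrite chi0//.
by rewrite leNgt y1.
Qed.

Lemma ess_inf_chi1 A D : mu (D `\` A) = 0 -> mu (D `&` A) != 0 ->
  ess_inf_on D (chi A) = 1.
Proof.
move=> DnA DA; apply/eqP; rewrite eq_le; apply/andP; split; last first.
  apply: ereal_sup_ubound; apply/lebesgue0_negligible.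
  apply/eqP; rewrite eq_le measure_ge0 andbT -DnA; apply: le_outer_measure => x /= nx.
  have [Dx|Dx] := pselect (D x); last by exfalso; apply: nx.
  split => // Ax; apply: nx => _; by rewrite chi1.
apply: ge_ereal_sup => y /lebesgue0_negligible yae; rewrite leNgt; apply/negP => y1.
move/eqP: DA; apply; apply/eqP; rewrite eq_le measure_ge0 andbT -yae.
apply: le_outer_measure => x [Dx Ax] /(_ Dx); rewrite chi1//.
by rewrite leNgt y1.
Qed.

(** Up to null sets, the points at which the essential supremum over the ball
    exceeds the indicator of [A]; for [inner_layer], those at which the essential
    infimum is less than the indicator. *)
Definition outer_layer Omega A e : set Rd :=
  (Omega `\` A) `&` [set x | mu (eball x e `&` A) != 0].

Definition inner_layer Omega A e : set Rd :=
  A `&` [set x | mu (eball x e `&` (Omega `\` A)) != 0].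

(** For almost every [x] in [Omega], whichever of [A] and [Omega `\` A] contains [x]
    has positive measure arbitrarily near [x]. This excludes the two cases in which the essential
    supremum would not be the expected one: [x] in [A] with [A] invisible near [x],
    and a ball meeting [Omega] in a null set. *)
Lemma outer_integrand Omega A e : open Omega -> A `<=` Omega -> (0 < e)%R ->
  \forall x \ae mu, Omega x ->
    ess_sup_on (eball x e `&` Omega) (chi A) - chi A x = chi (outer_layer Omega A e) x.
Proof.
move=> oO AO e0; apply/lebesgue0_negligible.
apply: sub_lebesgue0 (setU_lebesgue0 (positive_part_ae A) (positive_part_ae (Omega `\` A))).
move=> x nx; apply: contrapT => /not_orP[nA nOA]; apply: nx => Ox.
have DA : eball x e `&` Omega `&` A = eball x e `&` A by rewrite -setIA (setIidr AO).
have [Ax|Ax] := pselect (A x).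
  rewrite ess_sup_chi1; first by rewrite chi1// chi0 ?subee// => -[[]].
  rewrite DA; apply/eball_pos; exists x; last exact: eball_center.
  by apply: contrapT => px; apply: nA.
rewrite (chi0 Ax) sube0.
have [Ax0|Ax0] := eqVneq (mu (eball x e `&` A)) 0.
  rewrite chi0 => [|[_ /=]]; last by rewrite Ax0 eqxx.
  apply: ess_sup_chi0; first by rewrite DA.
  rewrite -setIDA; apply/eball_pos.
  exists x; last exact: eball_center.
  by apply: contrapT => px; apply: nOA.
by rewrite ess_sup_chi1 ?DA// chi1.
Qed.

Lemma inner_integrand Omega A e : open Omega -> A `<=` Omega -> (0 < e)%R ->
  \forall x \ae mu, Omega x ->
    chi A x - ess_inf_on (eball x e `&` Omega) (chi A) = chi (inner_layer Omega A e) x.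
Proof.
move=> oO AO e0; apply/lebesgue0_negligible.
apply: sub_lebesgue0 (setU_lebesgue0 (positive_part_ae A) (positive_part_ae (Omega `\` A))).
move=> x nx; apply: contrapT => /not_orP[nA nOA]; apply: nx => Ox.
have DA : eball x e `&` Omega `&` A = eball x e `&` A by rewrite -setIA (setIidr AO).
have DnA : (eball x e `&` Omega) `\` A = eball x e `&` (Omega `\` A) by rewrite setIDA.
have [Ax|Ax] := pselect (A x); last first.
  rewrite ess_inf_chi0; first by rewrite !chi0 ?sube0// => -[].
  rewrite DnA; apply/eball_pos; exists x; last exact: eball_center.
  by apply: contrapT => px; apply: nOA.
rewrite (chi1 Ax).
have [Ax0|Ax0] := eqVneq (mu (eball x e `&` (Omega `\` A))) 0.
  rewrite chi0 => [|[_ /=]]; last by rewrite Ax0 eqxx.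
  rewrite ess_inf_chi1 ?subee// ?DnA//.
  rewrite DA; apply/eball_pos.
  exists x; last exact: eball_center.
  by apply: contrapT => px; apply: nA.
by rewrite ess_inf_chi0 ?DnA// chi1 ?sube0.
Qed.

Lemma measurable_outer_layer Omega A e : measurable Omega -> measurable A ->
  measurable (outer_layer Omega A e).
Proof.
move=> mO mA; apply: measurableI; first exact: measurableD.
exact: measurable_eball_pos.
Qed.

Lemma measurable_inner_layer Omega A e : measurable Omega -> measurable A ->
  measurable (inner_layer Omega A e).
Proof.
move=> mO mA; apply: measurableI => //.
exact: measurable_eball_pos.
Qed.

Lemma integral_layer Omega T (g rho : Rd -> \bar R) : measurable Omega ->
  measurable T -> T `<=` Omega -> measurable_fun Omega rho ->
  (\forall x \ae mu, Omega x -> g x = chi T x) ->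
  \int[mu]_(x in Omega) (g x * rho x) = \int[mu]_(x in T) rho x.
Proof.
move=> mO mT TO mr gT.
have gr : \forall x \ae mu, Omega x -> g x * rho x = (rho \_ T) x.
  apply: filterS gT => x gT /gT ->; rewrite patchE.
  case: ifPn => [/set_mem Tx|/negP Tx]; first by rewrite chi1// mul1e.
  by rewrite chi0 ?mul0e// => Tx'; apply: Tx; exact: mem_set.
have mT' : measurable_fun Omega (rho \_ T).
  by apply/(measurable_restrict _ mT mO); apply: measurable_funS mr => // x [].
rewrite -[in RHS](setIidr TO) [RHS]integral_mkcondr.
apply: (ae_eq_integral _ _ mO _ mT' gr); exact: ae_measurable_fun gr mT'.
Qed.

Lemma ae_integral_ge0 D (f : Rd -> \bar R) : measurable D -> measurable_fun D f ->
  (\forall x \ae mu, D x -> 0 <= f x) -> 0 <= \int[mu]_(x in D) f x.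
Proof.
move=> mD mf f0; rewrite (ae_eq_integral (abse \o f)) //=.
- by apply: integral_ge0 => x _; exact: abse_ge0.
- exact: measurableT_comp.
- by apply: filterS f0 => x f0 /f0 /= {}f0; rewrite gee0_abs.
Qed.

(** Each of the two terms of the perimeter is bounded by the perimeter, because
    both are nonnegative. *)
Lemma Per_layers Omega (rho0 rho1 : Rd -> R) e A (M : R) :
  open Omega -> measurable A -> A `<=` Omega -> (0 < e)%R ->
  measurable_fun Omega rho0 -> measurable_fun Omega rho1 ->
  (\forall x \ae mu, Omega x -> 0 <= rho0 x)%R ->
  (\forall x \ae mu, Omega x -> 0 <= rho1 x)%R ->
  Per Omega rho0 rho1 e A <= M%:E ->
  \int[mu]_(x in outer_layer Omega A e) (rho0 x)%:E <= (e * M)%:E /\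
  \int[mu]_(x in inner_layer Omega A e) (rho1 x)%:E <= (e * M)%:E.
Proof.
move=> oO mA AO e0 m0 m1 r0 r1; have mO := open_measurable_Rd oO.
have mT := measurable_outer_layer e mO mA; have mS := measurable_inner_layer e mO mA.
have TO : outer_layer Omega A e `<=` Omega by move=> x [[]].
have SO : inner_layer Omega A e `<=` Omega by move=> x [/AO].
have m0' : measurable_fun Omega (EFin \o rho0) by exact/measurable_EFinP.
have m1' : measurable_fun Omega (EFin \o rho1) by exact/measurable_EFinP.
rewrite /Per (integral_layer mO mT TO m0' (outer_integrand oO AO e0)).
rewrite (integral_layer mO mS SO m1' (inner_integrand oO AO e0)) /=.
have : 0 <= \int[mu]_(x in outer_layer Omega A e) (rho0 x)%:E.
  apply: (ae_integral_ge0 mT); first exact: measurable_funS m0'.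
  by apply: filterS r0 => x r0 /TO /r0; rewrite lee_fin.
have : 0 <= \int[mu]_(x in inner_layer Omega A e) (rho1 x)%:E.
  apply: (ae_integral_ge0 mS); first exact: measurable_funS m1'.
  by apply: filterS r1 => x r1 /SO /r1; rewrite lee_fin.
move: (\int[mu]_(x in _) _) (\int[mu]_(x in _) _) => a b a0 b0.
have ei0 : 0 <= e^-1%:E by rewrite lee_fin invr_ge0 ltW.
move=> abM; have aM : e^-1%:E * a <= M%:E.
  by apply: (le_trans _ abM); rewrite leeDl// mule_ge0.
have bM : e^-1%:E * b <= M%:E.
  by apply: (le_trans _ abM); rewrite leeDr// mule_ge0.
have key c : e^-1%:E * c <= M%:E -> c <= (e * M)%:E.
  move=> h; have := lee_wpmul2l (_ : 0 <= e%:E) h; rewrite lee_fin (ltW e0).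
  by rewrite muleA -EFinM divff ?gt_eqF// mul1e EFinM => /(_ isT).
by split; apply: key.
Qed.

End perimeter.

(** * Compactly supported test functions *)

Section C1c.
Context {R : realType} {n : nat}.
Local Notation Rd := 'rV[R]_n.+1.
Local Notation mu := (@lebesgue R n).
Implicit Types (x y v : Rd) (i : 'I_n.+1) (e r t : R) (psi : Rd -> R).

(** The scalar counterpart of [supp]; [C1c] is that of the regularity required of
    test fields. *)
Definition ssupp psi : set Rd := closure [set x | psi x != 0].

Definition C1c psi := [/\ forall i x, derivable psi x (ebasis i),
  forall i, continuous ('D_(ebasis i) psi) & compact (ssupp psi)].

Lemma is_derive_along_line psi x v t : derivable psi (x + t *: v) v ->
  is_derive t 1 (fun s => psi (x + s *: v)) ('D_v psi (x + t *: v)).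
Proof.
set g := fun s => _.
have E : (fun h => h^-1 *: ((g \o shift t) (h *: (1 : R)) - g t)) =
  (fun h => h^-1 *: ((psi \o shift (x + t *: v)) (h *: v) - psi (x + t *: v))).
  apply: funext => h; rewrite /g /shift /= -[h *: 1]/(h * 1) mulr1 scalerDl.
  by congr (_ *: (psi _ - _)); rewrite addrCA.
move=> dpsi; split; first by rewrite /derivable E.
by rewrite /derive E.
Qed.

Lemma compact_bounded_fun (f : Rd -> R) (K : set Rd) : compact K -> continuous f ->
  (forall x, ~ K x -> f x = 0) -> exists M, 0 <= M /\ forall x, `|f x| <= M.
Proof.
move=> cK cf f0; have : compact (f @` K).
  by apply: continuous_compact => //; exact: continuous_subspaceT.
move=> /compact_bounded[M [Mreal HM]]; exists (`|M| + 1); split; first by rewrite addr_ge0.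
move=> x; have [Kx|Kx] := pselect (K x); last by rewrite f0// normr0 addr_ge0.
apply: HM; first by rewrite (le_lt_trans (ler_norm _))// ltrDl.
by exists x.
Qed.

Lemma notin_ssupp psi x : ~ ssupp psi x -> \forall y \near x, psi y = 0.
Proof.
move=> nx; have : open_nbhs x (~` ssupp psi).
  by split=> //; apply: closed_openC; exact: closed_closure.
move=> /open_nbhs_nbhs; apply: filterS => y ny; apply: contrapT => /eqP psiy.
by apply: ny; exact: subset_closure.
Qed.

Lemma derive_notin_ssupp psi x v : v != 0 -> ~ ssupp psi x -> 'D_v psi x = 0.
Proof.
move=> v0 /notin_ssupp px; rewrite (@near_eq_derive _ _ _ _ (cst 0) x v px).
exact: derive_cst.
Qed.

Lemma ebasis_neq0 i : ebasis i != 0 :> Rd.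
Proof.
apply/eqP => /matrixP/(_ ord0 i); rewrite !mxE !eqxx/= => /eqP.
by rewrite oner_eq0.
Qed.

Lemma C1c_derive_bounded psi i : C1c psi ->
  exists M, 0 <= M /\ forall x, `|'D_(ebasis i) psi x| <= M.
Proof.
move=> [_ cd cs]; apply: compact_bounded_fun cs (cd i) _ => x.
exact/derive_notin_ssupp/ebasis_neq0.
Qed.

Lemma C1c_lipschitz_coord psi i M : C1c psi -> (forall x, `|'D_(ebasis i) psi x| <= M) ->
  forall x t, `|psi (x + t *: ebasis i) - psi x| <= M * `|t|.
Proof.
move=> [dp _ _] HM.
have key x t : 0 <= t -> `|psi (x + t *: ebasis i) - psi x| <= M * `|t|.
  move=> t0; pose g s := psi (x + s *: ebasis i).
  have dg (s : R) : is_derive s 1 g ('D_(ebasis i) psi (x + s *: ebasis i)).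
    exact: is_derive_along_line.
  have gc : {within `[0, t], continuous g}.
    apply: continuous_subspaceT => s; apply: differentiable_continuous.
    by apply/derivable1_diffP; have [] := dg s.
  have [c _ gE] := MVT_segment t0 (fun s _ => dg s) gc.
  have := gE; rewrite /g scale0r addr0 subr0 => ->.
  by rewrite normrM ler_wpM2r.
move=> x t; have [t0|t0] := leP 0 t; first exact: key.
have := key (x + t *: ebasis i) (- t); rewrite scaleNr addrK distrC normrN.
by apply; rewrite oppr_ge0 ltW.
Qed.

(** Only partial derivatives are at hand. They are bounded, so the mean value
    theorem along each axis bounds the increment of [psi] one coordinate at a time. *)
Lemma C1c_continuous psi : C1c psi -> continuous psi.
Proof.
move=> Cpsi; have /choice[M HM] : forall i, exists M, 0 <= M /\
    forall x, `|'D_(ebasis i) psi x| <= M.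
  by move=> i; exact: C1c_derive_bounded.
have lip x v (s : seq 'I_n.+1) :
    `|psi (x + \sum_(j <- s) v ord0 j *: ebasis j) - psi x| <=
    \sum_(j <- s) M j * `|v ord0 j|.
  elim: s => [|j s IH]; first by rewrite !big_nil addr0 subrr normr0.
  rewrite !big_cons [X in _ - X](_ : psi x = psi (x + \sum_(j <- s) v ord0 j *: ebasis j)
    - (psi (x + \sum_(j <- s) v ord0 j *: ebasis j) - psi x)); last by ring.
  rewrite opprB addrA [X in `|X|](_ : _ =
    (psi (x + (v ord0 j *: ebasis j + \sum_(j <- s) v ord0 j *: ebasis j)) -
     psi (x + \sum_(j <- s) v ord0 j *: ebasis j)) +
    (psi (x + \sum_(j <- s) v ord0 j *: ebasis j) - psi x)); last by ring.
  rewrite (le_trans (ler_normD _ _))// lerD//.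
  rewrite [X in psi (x + X)]addrC addrA; apply: C1c_lipschitz_coord => //.
  by have [] := HM j.
move=> x; pose h (y : Rd) : R := \sum_j M j * `|y ord0 j - x ord0 j|.
have ch : continuous h.
  apply: continuous_big => [|j _ y]; first exact: add_continuous.
  apply: (@continuousM _ _ (cst (M j)) (fun y : Rd => `|y ord0 j - x ord0 j|)); first exact: cst_continuous.
  apply: (@continuous_comp _ _ _ (fun y : Rd => y ord0 j - x ord0 j) Num.norm).
    by apply: (@continuousB _ _ _ (fun z : Rd => z ord0 j) (cst (x ord0 j))); [exact: coord_continuous|exact: cst_continuous].
  exact: norm_continuous.
have hx : h x = 0 by rewrite /h big1// => j _; rewrite subrr normr0 mulr0.
apply/(@cvgrPdist_lt _ _ _ (nbhs (x : Rd)) _ psi (psi x)) => e e0.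
have : \forall y \near x, h y < e by apply: (@cvgr_lt _ _ _ _ h (h x) (ch x)); rewrite hx.
apply: filterS => y; apply: le_lt_trans; rewrite distrC.
have := lip x (y - x) (index_enum _).
have -> : \sum_(j <- index_enum 'I_n.+1) (y - x) ord0 j *: ebasis j = y - x.
  by rewrite -row_sum_delta.
rewrite (_ : x + (y - x) = y); last by rewrite addrC subrK.
move=> /le_trans; apply.
by rewrite le_eqVlt; apply/orP; left; apply/eqP/eq_bigr => j _; rewrite !mxE.
Qed.

Lemma C1c_bounded psi : C1c psi -> exists M, 0 <= M /\ forall x, `|psi x| <= M.
Proof.
move=> Cpsi; have [_ _ cs] := Cpsi.
apply: compact_bounded_fun cs (C1c_continuous Cpsi) _ => x /notin_ssupp.
exact: nbhs_singleton.
Qed.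

Let shift_quotient psi x y v :
  (fun h => h^-1 *: (((fun z => psi (z + y)) \o shift x) (h *: v) - psi (x + y))) =
  (fun h => h^-1 *: ((psi \o shift (x + y)) (h *: v) - psi (x + y))).
Proof. by apply: funext => h; rewrite /shift /= addrA. Qed.

Lemma derivable_shift psi x y v : derivable psi (x + y) v ->
  derivable (fun z => psi (z + y)) x v.
Proof. by rewrite /derivable shift_quotient. Qed.

Lemma derive_shiftE psi x y v : 'D_v (fun z => psi (z + y)) x = 'D_v psi (x + y).
Proof. by rewrite /derive shift_quotient. Qed.

Lemma ssupp_sub_closed psi (C : set Rd) : closed C ->
  (forall x, psi x != 0 -> C x) -> ssupp psi `<=` C.
Proof.
move=> cC psiC; rewrite [X in _ `<=` X](_ : C = closure C); last exact/closure_id.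
by apply: closure_subset => x; exact: psiC.
Qed.

Lemma continuous_addr y : continuous (fun z : Rd => z + y).
Proof. by move=> z; apply: (@continuousD _ _ _ id (cst y)); [exact: cvg_id|exact: cst_continuous]. Qed.

Lemma ssupp_shift psi y : compact (ssupp psi) ->
  compact (ssupp (fun z => psi (z + y))) /\
  forall x, ssupp (fun z => psi (z + y)) x -> ssupp psi (x + y).
Proof.
move=> cs; have cI : compact ((fun z : Rd => z - y) @` ssupp psi).
  by apply: continuous_compact => //; apply: continuous_subspaceT; exact: continuous_addr.
have sI : ssupp (fun z => psi (z + y)) `<=` (fun z : Rd => z - y) @` ssupp psi.
  apply: ssupp_sub_closed => [|x px]; first exact: compact_closed.
  by exists (x + y); [exact: subset_closure|rewrite addrK].
split; first by apply: subclosed_compact cI sI; exact: closed_closure.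
by move=> x /sI[z sz <-]; rewrite subrK.
Qed.

Lemma C1c_shift psi y : C1c psi -> C1c (fun z => psi (z + y)).
Proof.
move=> [dp cd cs]; split; last by have [] := ssupp_shift y cs.
- by move=> i x; apply: derivable_shift; exact: dp.
- move=> i; rewrite (_ : 'D__ _ = (fun z => 'D_(ebasis i) psi (z + y))).
    move=> x; apply: (@continuous_comp _ _ _ (fun z : Rd => z + y) ('D_(ebasis i) psi) x); first exact: continuous_addr.
    exact: cd.
  by apply: funext => x; exact: derive_shiftE.
Qed.

End C1c.

(** * Variation and translated test functions *)

Section differentiation_under_the_integral.
Context {R : realType} {n : nat}.
Local Notation Rd := 'rV[R]_n.+1.
Local Notation mu := (@lebesgue R n).
Implicit Types (x y v : Rd) (i : 'I_n.+1) (e r t : R) (psi u : Rd -> R).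

Lemma integrable_mul_bounded (Omega : set Rd) u psi : measurable Omega ->
  mu.-integrable Omega (EFin \o u) -> measurable_fun setT psi ->
  (exists M, forall x, `|psi x| <= M) ->
  mu.-integrable Omega (EFin \o (fun x => u x * psi x)).
Proof.
move=> mO iu mpsi [M HM].
have -> : EFin \o (fun x => u x * psi x) = ((EFin \o u) \* (EFin \o psi))%E.
  by apply: funext => x; rewrite /= EFinM.
apply: integrableMl => //; first exact: measurable_funTS.
exists M; split => [|y My]; first exact: num_real.
move=> x _; exact: le_trans (HM x) (ltW My).
Qed.

Lemma is_derive_integral_shift (Omega : set Rd) u psi i t : measurable Omega ->
  mu.-integrable Omega (EFin \o u) -> C1c psi ->
  is_derive t 1 (fun s => \int[mu]_(x in Omega) (u x * psi (x + s *: ebasis i)))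
    (\int[mu]_(x in Omega) (u x * 'D_(ebasis i) psi (x + t *: ebasis i))).
Proof.
move=> mO iu Cpsi.
pose f (s : R) (x : Rd) := u x * psi (x + s *: ebasis i).
have [P [P0 HP]] := C1c_bounded Cpsi.
have [M [M0 HM]] := C1c_derive_bounded i Cpsi.
have It : `]t - 1, t + 1[%classic t by rewrite /= in_itv/= ltrBlDr !ltrDl ltr01.
have fint (s : R) : mu.-integrable Omega (EFin \o f s).
  have mpsi : measurable_fun setT (fun x => psi (x + s *: ebasis i)).
    by apply: continuous_measurable_Rd; apply: C1c_continuous; exact: C1c_shift.
  exact: (integrable_mul_bounded mO iu mpsi (ex_intro _ P (fun x => HP _))).
have df (s : R) (x : Rd) : is_derive s 1 (f^~ x) (u x * 'D_(ebasis i) psi (x + s *: ebasis i)).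
  have [dp _ _] := Cpsi.
  have H := is_derive_along_line (dp i (x + s *: ebasis i)).
  exact: is_deriveZ.
have Gint : mu.-integrable Omega (EFin \o (fun x => `|u x| * M)).
  apply: (integrable_mul_bounded (u := fun x => `|u x|) (psi := cst M)) => //; last by exists `|M|.
  exact: (integrable_norm iu).
have fb (s : R) (x : Rd) : (`]t - 1, t + 1[%classic s) -> Omega x -> `|partial1of2 f s x| <= `|u x| * M.
  move=> _ _; rewrite partial1of2E; have [_ ->] := df s x.
  by rewrite normrM ler_wpM2l.
have G0 (x : Rd) : 0 <= `|u x| * M by rewrite mulr_ge0.
have dfI (s : R) (x : Rd) : (`]t - 1, t + 1[%classic s) -> Omega x -> derivable (f^~ x) s 1.
  by move=> _ _; have [] := df s x.
have fI (s : R) : (`]t - 1, t + 1[%classic s) -> mu.-integrable Omega (EFin \o f s) by [].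
split; first exact: (derivable_under_integral mO It fI dfI G0 Gint fb).
have := differentiation_under_integral mO It fI dfI G0 Gint fb.
rewrite derive1E => ->; apply: eq_Rintegral => x _.
by rewrite partial1of2E; have [_ ->] := df t x.
Qed.

Definition scalar_field psi i : Rd -> Rd := fun x => psi x *: ebasis i.

Lemma scalar_field_quotient psi i x v :
 (fun h => h^-1 *: ((scalar_field psi i \o shift x) (h *: v) - scalar_field psi i x)) =
 (fun h => (h^-1 *: ((psi \o shift x) (h *: v) - psi x)) *: ebasis i).
Proof. by apply: funext => h; rewrite /scalar_field /= -scalerBl scalerA. Qed.

Lemma is_derive_scalar_field psi i x v : derivable psi x v ->
  is_derive x v (scalar_field psi i) ('D_v psi x *: ebasis i).
Proof.
move=> dp; have H : h^-1 *: ((scalar_field psi i \o shift x) (h *: v) - scalar_field psi i x) @[h --> 0^'] --> 'D_v psi x *: ebasis i.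
  by rewrite scalar_field_quotient; apply: cvgZr_tmp; exact: dp.
by split; [apply/cvg_ex; eexists; exact: H|exact: (cvg_lim _ H)].
Qed.

Lemma continuous_scalel (f : Rd -> R) v : continuous f -> continuous (fun x => f x *: v).
Proof.
move=> cf x; have fx : f y @[y --> x] --> f x := cf x.
pose g (k : R) := k *: v.
have gc : continuous g by move=> k; apply: cvgZr_tmp; exact: cvg_id.
exact: (@continuous_comp _ _ _ f g x (cf x) (gc _)).
Qed.

Lemma continuous_oppf (f : Rd -> R) : continuous f -> continuous (fun x => - f x).
Proof.
move=> cf x; pose g (k : R) := - k.
have gc : continuous g by exact: opp_continuous.
exact: (@continuous_comp _ _ _ f g x (cf x) (gc _)).
Qed.

(** Both [psi] and [- psi], times a basis vector, are test fields. *)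
Lemma Rintegral_derive_le_variation (Omega : set Rd) u psi i (V : R) :
  measurable Omega -> mu.-integrable Omega (EFin \o u) ->
  C1c psi -> ssupp psi `<=` Omega -> (forall x, `|psi x| <= 1) ->
  (Defs.variation Omega u <= V%:E)%E ->
  `|\int[mu]_(x in Omega) (u x * 'D_(ebasis i) psi x)| <= V.
Proof.
move=> mO iu.
have key psi' : C1c psi' -> ssupp psi' `<=` Omega -> (forall x, `|psi' x| <= 1) ->
  (Defs.variation Omega u <= V%:E)%E ->
  \int[mu]_(x in Omega) (u x * 'D_(ebasis i) psi' x) <= V.
  move=> Cpsi sO p1 uV; have [dp cd cs] := Cpsi.
  have DE j : 'D_(ebasis j) (scalar_field psi' i) = (fun x => 'D_(ebasis j) psi' x *: ebasis i).
    by apply: funext => x; have [_ ->] := is_derive_scalar_field i (dp j x).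
  have divE : divergence (scalar_field psi' i) = 'D_(ebasis i) psi'.
    apply: funext => x; transitivity (\sum_j 'D_(ebasis j) psi' x * (j == i)%:R).
      apply: eq_bigr => j _.
      have D1 : ('D_(ebasis j) (scalar_field psi' i) x : Rd) ord0 j = 'D_(ebasis j) psi' x * (j == i)%:R.
        by have [_ ->] := is_derive_scalar_field i (dp j x); rewrite !mxE eqxx.
      exact: D1.
    rewrite (bigD1 i)// big1 => [|j /negbTE ji]; last by rewrite ji mulr0.
    by rewrite /= eqxx mulr1 addr0.
  have [M [M0 HM]] := C1c_derive_bounded i Cpsi.
  have int : mu.-integrable Omega (EFin \o (fun x => u x * 'D_(ebasis i) psi' x)).
    have mD : measurable_fun setT ('D_(ebasis i) psi').
      by apply: continuous_measurable_Rd; exact: cd.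
    exact: (integrable_mul_bounded mO iu mD (ex_intro _ M HM)).
  rewrite -lee_fin; apply: le_trans uV.
  rewrite /Rintegral fineK; last exact: integrable_fin_num.
  apply: ereal_sup_ubound; exists (scalar_field psi' i); last by rewrite divE.
  have sE : [set x | scalar_field psi' i x != 0] = [set x | psi' x != 0].
    by apply/seteqP; split=> x; rewrite /= scaler_eq0 (negbTE (ebasis_neq0 i)) orbF.
  split; rewrite ?/supp ?sE//.
  - move=> j; split=> [x|]; first by have [] := is_derive_scalar_field i (dp j x).
    by rewrite DE; exact/continuous_scalel/cd.
  - move=> x; rewrite /enorm (eq_bigr (fun j => if j == i then psi' x ^+ 2 else 0)); last first.
      by move=> j _; rewrite !mxE eqxx /=; case: eqP => _; rewrite ?mulr1 ?mulr0 ?expr0n.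
    by rewrite -big_mkcond big_pred1_eq sqrtr_sqr.
move=> Cpsi sO p1 uV; rewrite ler_norml key// andbT.
have [dp cd cs] := Cpsi.
have DE (j : 'I_n.+1) : 'D_(ebasis j) (fun x => - psi x) = (fun x => - 'D_(ebasis j) psi x).
  by apply: funext => x; exact: deriveN.
have sE : ssupp (fun x => - psi x) = ssupp psi.
  by rewrite /ssupp; congr closure; apply/seteqP; split=> x; rewrite /= oppr_eq0.
have CN : C1c (fun x => - psi x).
  split; last by rewrite sE.
  - by move=> j x; apply: derivableN; exact: dp.
  - move=> j; by rewrite DE; exact/continuous_oppf/cd.
have := key _ CN; rewrite sE => /(_ sO).
have DEx x : 'D_(ebasis i) (fun x => - psi x) x = - 'D_(ebasis i) psi x by exact: deriveN.
have [M [M0 HM]] := C1c_derive_bounded i Cpsi.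
under eq_Rintegral do rewrite DEx mulrN -mulN1r.
rewrite RintegralZl//; last first.
  have mD : measurable_fun setT ('D_(ebasis i) psi).
    by apply: continuous_measurable_Rd; exact: cd.
  exact: (integrable_mul_bounded mO iu mD (ex_intro _ M HM)).
rewrite mulN1r lerNl => -> // x; by rewrite normrN.
Qed.

(** The mean value theorem for the integral of [u] against [psi] translated by
    [s], [s] between [- t] and [0]: its derivative in [s] tests [u] against the
    partial derivative of a translate of [psi]. *)
Lemma variation_test_shift (Omega : set Rd) u psi i (V t : R) :
  measurable Omega -> mu.-integrable Omega (EFin \o u) ->
  (Defs.variation Omega u <= V%:E)%E -> C1c psi -> (forall x, `|psi x| <= 1) -> 0 <= t ->
  (forall x s, ssupp psi x -> 0 <= s <= t -> Omega (x + s *: ebasis i)) ->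
  `|\int[mu]_(x in Omega) (u x * psi x) -
    \int[mu]_(x in Omega) (u x * psi (x - t *: ebasis i))| <= V * t.
Proof.
move=> mO iu uV Cpsi p1 t0 sO; have [_ _ cs] := Cpsi.
pose F s := \int[mu]_(x in Omega) (u x * psi (x + s *: ebasis i)).
pose dF s := \int[mu]_(x in Omega) (u x * 'D_(ebasis i) psi (x + s *: ebasis i)).
have dFF (s : R) : is_derive s 1 F (dF s) by exact: is_derive_integral_shift.
have Fc : {within `[- t, 0], continuous F}.
  apply: continuous_subspaceT => s; apply: differentiable_continuous.
  by apply/derivable1_diffP; have [] := dFF s.
have tt : - t <= 0 by rewrite oppr_le0.
have [c ct FE] := MVT_segment tt (fun s _ => dFF s) Fc.
have -> : \int[mu]_(x in Omega) (u x * psi x) = F 0.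
  by apply: eq_Rintegral => x _; rewrite scale0r addr0.
have -> : \int[mu]_(x in Omega) (u x * psi (x - t *: ebasis i)) = F (- t).
  by apply: eq_Rintegral => x _; rewrite scaleNr.
rewrite FE sub0r opprK normrM (ger0_norm t0) ler_wpM2r//.
have -> : dF c = \int[mu]_(x in Omega) (u x * 'D_(ebasis i) (fun z => psi (z + c *: ebasis i)) x).
  by apply: eq_Rintegral => x _; rewrite derive_shiftE.
apply: Rintegral_derive_le_variation => //; first exact: C1c_shift.
move=> x /(ssupp_shift (c *: ebasis i) cs).2 sx.
move: ct; rewrite in_itv/= => /andP[c1 c2].
have := sO _ (- c) sx; rewrite scaleNr addrK; apply.
by rewrite oppr_ge0 c2 lerNl.
Qed.

End differentiation_under_the_integral.

(** * Smooth approximations of the indicator of a union of balls *)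

Section bump_functions.
Context {R : realType} {n : nat}.
Local Notation Rd := 'rV[R]_n.+1.
Local Notation mu := (@lebesgue R n).
Implicit Types (x y v c : Rd) (i : 'I_n.+1) (e r t s : R) (psi f g : Rd -> R).

(** The functions differentiated below are quadratic along each axis, up to a
    positive part, so their Taylor remainder is an explicit multiple of [h ^+ 2]. *)
Lemma is_derive_quadratic (f : R -> R) (a L C : R) :
  (forall h, `|f (h + a) - f a - L * h| <= C * h ^+ 2) -> is_derive a 1 f L.
Proof.
move=> fC; have C0 : 0 <= C.
  by have := le_trans (normr_ge0 _) (fC 1); rewrite expr1n mulr1.
have H : h^-1 *: ((f \o shift a) (h *: (1 : R)) - f a) @[h --> 0^'] --> L.
  apply/cvgrPdist_lt => e e0.
  have d0 : 0 < e / (C + 1) by rewrite divr_gt0// ltr_wpDl.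
  near=> h.
  have h0 : h != 0 by near: h; exact: nbhs_dnbhs_neq.
  rewrite /shift /= -[h *: 1]/(h * 1) mulr1.
  have -> : L - h^-1 *: (f (h + a) - f a) = - (h^-1 * (f (h + a) - f a - L * h)).
    by rewrite -[_ *: _]/(_ * _); field.
  rewrite normrN normrM normfV.
  apply: (@le_lt_trans _ _ (C * `|h|)).
    rewrite ler_pdivrMl ?normr_gt0//; apply: le_trans (fC h) _.
    by rewrite -[h ^+ 2]real_normK ?num_real// expr2; lra.
  have hd : `|h| < e / (C + 1) by near: h; apply: dnbhs0_lt.
  apply: (@le_lt_trans _ _ ((C + 1) * `|h|)); first by rewrite ler_wpM2r// lerDl.
  by rewrite -ltr_pdivlMl ?ltr_wpDl// mulrC.
by split; [apply/cvg_ex; eexists; exact: H|exact: (cvg_lim _ H)].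
Unshelve. all: by end_near. Qed.

(** Squaring makes the positive part differentiable at [0]. *)
Definition sqr_pos (z : R) : R := Num.max z 0 ^+ 2.

Lemma is_derive_sqr_pos (z : R) : is_derive z 1 sqr_pos (2 * Num.max z 0).
Proof.
apply: (is_derive_quadratic (C := 1)) => h; rewrite /sqr_pos mul1r.
case: (leP (h + z) 0) => hz; case: (leP z 0) => z0; rewrite ler_norml; apply/andP; split; nra.
Qed.

Lemma is_derive_of_line psi x v d : is_derive (0 : R) (1 : R) (fun s : R => psi (x + s *: v)) d ->
  is_derive x v psi d.
Proof.
set g := fun s => _.
have E : (fun h => h^-1 *: ((g \o shift 0) (h *: (1 : R)) - g 0)) =
  (fun h => h^-1 *: ((psi \o shift x) (h *: v) - psi x)).
  apply: funext => h; rewrite /g /shift /= -[h *: 1]/(h * 1) mulr1 addr0 scale0r addr0.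
  by congr (_ *: (psi _ - _)); rewrite addrC.
move=> [dg dgE]; split; first by move: dg; rewrite /derivable E.
by rewrite -dgE /derive E.
Qed.

Definition sqdist c x : R := \sum_j (x ord0 j - c ord0 j) ^+ 2.

Lemma sqdist_line c x i t :
  sqdist c (x + t *: ebasis i) = sqdist c x + (2 * (x ord0 i - c ord0 i) * t + t ^+ 2).
Proof.
rewrite /sqdist (bigD1 i)//= [in RHS](bigD1 i)//= !mxE !eqxx /= mulr1.
rewrite (eq_bigr (fun j => (x ord0 j - c ord0 j) ^+ 2)); first by ring.
by move=> j /negbTE ji; rewrite !mxE ji mulr0 addr0.
Qed.

Lemma continuous_coordB c i : continuous (fun x : Rd => x ord0 i - c ord0 i).
Proof.
move=> x; apply: (@continuousB _ _ _ (fun z : Rd => z ord0 i) (cst (c ord0 i))).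
  exact: coord_continuous.
exact: cst_continuous.
Qed.

Lemma continuous_sqdist c : continuous (sqdist c).
Proof.
apply: continuous_big => [|i _ y]; first exact: add_continuous.
apply: (@continuous_comp _ _ _ (fun y : Rd => y ord0 i - c ord0 i) (fun z => z ^+ 2)).
  exact: continuous_coordB.
exact: exprn_continuous.
Qed.

Lemma eball_sqdist c s x : 0 < s -> eball c s x <-> sqdist c x < s ^+ 2.
Proof.
move=> s0; rewrite /eball /= /enorm.
rewrite (_ : \sum_i _ = sqdist c x); last by apply: eq_bigr => j _; rewrite !mxE.
have H := ltr_sqrt (sqdist c x) (exprn_gt0 2 s0).
by rewrite sqrtr_sqr gtr0_norm// in H; rewrite -H.
Qed.

Definition ball_bump c s x : R := sqr_pos (s ^+ 2 - sqdist c x).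

Definition C1 f := [/\ continuous f, forall i x, derivable f x (ebasis i) &
  forall i, continuous ('D_(ebasis i) f)].

Lemma C1_ball_bump c s : C1 (ball_bump c s).
Proof.
have cq : continuous (fun x => s ^+ 2 - sqdist c x).
  move=> x; apply: (@continuousB _ _ _ (cst (s ^+ 2)) (sqdist c)); first exact: cst_continuous.
  exact: continuous_sqdist.
have dB i x : is_derive x (ebasis i) (ball_bump c s)
    (2 * Num.max (s ^+ 2 - sqdist c x) 0 * - (2 * (x ord0 i - c ord0 i))).
  apply: is_derive_of_line.
  pose q (t : R) := s ^+ 2 - sqdist c x - (2 * (x ord0 i - c ord0 i) * t + t ^+ 2).
  have -> : (fun t : R => ball_bump c s (x + t *: ebasis i)) = sqr_pos \o q.
    by apply: funext => t; rewrite /ball_bump sqdist_line /= /q opprD addrA.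
  have q0 : q 0 = s ^+ 2 - sqdist c x by rewrite /q; ring.
  apply: is_derive1_comp; first by rewrite -q0; exact: is_derive_sqr_pos.
  apply: (is_derive_quadratic (C := 1)) => h; rewrite /q addr0.
  rewrite (_ : _ - _ - _ = - h ^+ 2); last by ring.
  by rewrite normrN ger0_norm ?sqr_ge0 ?mul1r.
have cmax : continuous (fun z : R => 2 * Num.max z 0).
  have cm : continuous (fun z : R => Num.max z 0).
    by move=> z; apply: (@continuous_max _ _ id (cst 0)); [exact: cvg_id|exact: cst_continuous].
  move=> z; apply: (@continuousM _ _ (cst (2 : R)) (fun z : R => Num.max z 0) z); last exact: cm.
  exact: cst_continuous.
split.
- move=> x; apply: (@continuous_comp _ _ _ (fun x => s ^+ 2 - sqdist c x) sqr_pos); first exact: cq.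
  apply: differentiable_continuous; apply/derivable1_diffP.
  by have [] := is_derive_sqr_pos (s ^+ 2 - sqdist c x).
- by move=> i x; have [] := dB i x.
- move=> i; rewrite (_ : 'D__ _ = fun x => 2 * Num.max (s ^+ 2 - sqdist c x) 0 * - (2 * (x ord0 i - c ord0 i))).
    move=> x; apply: (@continuousM _ _ (fun x => 2 * Num.max (s ^+ 2 - sqdist c x) 0) (fun x => - (2 * (x ord0 i - c ord0 i)))).
      exact: (@continuous_comp _ _ _ (fun x => s ^+ 2 - sqdist c x) (fun z => 2 * Num.max z 0) x (cq x) (cmax _)).
    apply: (@continuousN _ _ _ (fun x => (2 * (x ord0 i - c ord0 i)))).
    apply: (@continuousM _ _ (cst 2) (fun x => (x ord0 i - c ord0 i))); first exact: cst_continuous.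
    exact: continuous_coordB.
  by apply: funext => x; have [_ ->] := dB i x.
Qed.

Lemma C1_cst k : C1 (cst k).
Proof.
split; [exact: cst_continuous|by move=> i x; exact: derivable_cst|move=> i].
rewrite (_ : 'D__ _ = cst 0); first exact: cst_continuous.
by apply: funext => x; exact: derive_cst.
Qed.

Lemma C1_add f g : C1 f -> C1 g -> C1 (fun x => f x + g x).
Proof.
move=> [cf df ccf] [cg dg cg']; split.
- by move=> x; apply: (@continuousD _ _ _ f g x); [exact: cf|exact: cg].
- by move=> i x; apply: derivableD.
- move=> i; rewrite (_ : 'D__ _ = fun x => 'D_(ebasis i) f x + 'D_(ebasis i) g x).
    by move=> x; apply: (@continuousD _ _ _ ('D_(ebasis i) f) ('D_(ebasis i) g) x); [exact: ccf|exact: cg'].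
  by apply: funext => x; exact: deriveD.
Qed.

Lemma C1_mul f g : C1 f -> C1 g -> C1 (fun x => f x * g x).
Proof.
move=> [cf df ccf] [cg dg cg']; split.
- by move=> x; apply: (@continuousM _ _ f g x); [exact: cf|exact: cg].
- by move=> i x; apply: derivableM.
- move=> i; rewrite (_ : 'D__ _ = fun x => f x * 'D_(ebasis i) g x + g x * 'D_(ebasis i) f x).
    move=> x; apply: (@continuousD _ _ _ (fun x => f x * 'D_(ebasis i) g x) (fun x => g x * 'D_(ebasis i) f x) x).
      by apply: (@continuousM _ _ f ('D_(ebasis i) g) x); [exact: cf|exact: cg'].
    by apply: (@continuousM _ _ g ('D_(ebasis i) f) x); [exact: cg|exact: ccf].
  by apply: funext => x; exact: deriveM.
Qed.

Lemma C1_exp f N : C1 f -> C1 (fun x => f x ^+ N).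
Proof.
move=> Cf; elim: N => [|N IH]; first exact: (C1_cst 1).
by have := C1_mul Cf IH; congr C1; apply: funext => x; rewrite exprS.
Qed.

Lemma C1c_C1 f : C1 f -> compact (ssupp f) -> C1c f.
Proof. by move=> [_ df cf] cs; split. Qed.

Definition ball_union (L : seq (Rd * R)) : set Rd :=
  [set x | exists2 p, p \in L & eball p.1 p.2 x].

Lemma open_ball_union L : open (ball_union L).
Proof.
rewrite (_ : ball_union L = \bigcup_(p in [set p | p \in L]) eball p.1 p.2) //.
by apply: bigcup_open => p _; exact: open_eball.
Qed.

Lemma ball_union_bump (L : seq (Rd * R)) : (forall p, p \in L -> 0 < p.2) ->
  exists p : Rd -> R, C1 p /\ (exists K, 0 < K /\ forall x, 0 <= p x <= K) /\
    forall x, ball_union L x <-> p x != 0.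
Proof.
elim: L => [|[c s] L IH] L0.
  exists (cst 0); split; first exact: C1_cst.
  split; first by exists 1; split => // x; rewrite lexx ler01.
  by move=> x; split=> [[]//|/=]; rewrite eqxx.
have [p [Cp [[K [K0 pK]] pL]]] : _ := IH (fun q qL => L0 q (mem_behead (s := _ :: _) qL)).
have s0 : 0 < s by have := L0 (c, s) (mem_head _ _).
have b0 x : 0 <= ball_bump c s x by exact: sqr_ge0.
have q0 x : 0 <= sqdist c x by apply: sumr_ge0 => j _; exact: sqr_ge0.
have bE x : (ball_bump c s x != 0) = (sqdist c x < s ^+ 2).
  rewrite /ball_bump /sqr_pos sqrf_eq0 -subr_gt0; move: (s ^+ 2 - _) => z.
  by case: (leP z 0) => h; [rewrite eqxx|rewrite gt_eqF].
exists (fun x => ball_bump c s x + p x); split; first by apply: C1_add => //; exact: C1_ball_bump.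
split.
  exists ((s ^+ 2) ^+ 2 + K); split => [|x]; first by rewrite ltr_wpDl ?sqr_ge0.
  have /andP[p0 p1] := pK x; rewrite addr_ge0//= lerD//.
  rewrite /ball_bump /sqr_pos ler_sqr ?nnegrE ?sqr_ge0//; last by rewrite le_max lexx orbT.
  by rewrite ge_max sqr_ge0 andbT lerBlDr lerDl.
move=> x; have /andP[p0 _] := pK x; rewrite paddr_eq0// negb_and; split.
  move=> [q]; rewrite inE => /orP[/eqP->/=|qL qx].
    by move=> /(eball_sqdist _ _ s0); rewrite bE => ->.
  by apply/orP; right; apply/pL; exists q.
move=> /orP[|/pL[q qL qx]]; last by exists q => //; rewrite inE qL orbT.
by rewrite bE => h; exists (c, s); rewrite ?mem_head//=; apply/eball_sqdist.
Qed.

(** Take [1 - (1 - p / K) ^+ N], where [p] has values between [0] and [K] and is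
    positive exactly on the union: it vanishes off the union and tends to [1] on
    it. *)
Lemma ball_union_approx (L : seq (Rd * R)) (C : set Rd) :
  (forall p, p \in L -> 0 < p.2) -> compact C -> ball_union L `<=` C ->
  exists psi : nat -> Rd -> R, [/\ forall N, C1c (psi N), forall N x, `|psi N x| <= 1,
    forall N, ssupp (psi N) `<=` C &
    forall x, psi N x @[N --> \oo] --> (\1_(ball_union L) x : R)].
Proof.
move=> L0 cC LC; have [p [Cp [[K [K0 pK]] pL]]] := ball_union_bump L0.
pose a x := 1 - p x / K.
have a01 x : 0 <= a x <= 1.
  have /andP[p0 p1] := pK x; rewrite /a subr_ge0 ler_pdivrMr// mul1r p1/=.
  by rewrite lerBlDr lerDl divr_ge0// ltW.
have Ca : C1 a.
  have := C1_add (C1_cst 1) (C1_mul (C1_cst (- K^-1)) Cp).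
  by congr C1; apply: funext => x; rewrite /a /=; ring.
pose psi N x := 1 - a x ^+ N.
have Cpsi N : C1 (psi N).
  have := C1_add (C1_cst 1) (C1_mul (C1_cst (- 1)) (C1_exp N Ca)).
  by congr C1; apply: funext => x; rewrite /psi /=; ring.
have sC N : ssupp (psi N) `<=` C.
  apply: ssupp_sub_closed; first exact: compact_closed.
  move=> x psi0; apply: LC; apply/pL; apply: contra psi0 => /eqP px.
  by rewrite /psi /a px mul0r subr0 expr1n subrr.
exists psi; split => //.
- move=> N; apply: C1c_C1 => //; apply: subclosed_compact cC (sC N).
  exact: closed_closure.
- move=> N x; have /andP[a0 a1] := a01 x; rewrite /psi ger0_norm.
    by rewrite lerBlDr lerDl exprn_ge0.
  by rewrite subr_ge0 exprn_ile1.
- move=> x; have [Lx|Lx] := pselect (ball_union L x).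
    rewrite indicE mem_set// -[X in _ --> X]subr0; apply: cvgB; first exact: cvg_cst.
    apply: cvg_expr; have /andP[a0 a1] := a01 x; rewrite ger0_norm//.
    rewrite /a ltrBlDr ltrDl divr_gt0// lt_neqAle eq_sym; have /andP[-> _] := pK x.
    by rewrite andbT; apply/pL.
  rewrite indicE memNset//; apply: cvg_near_cst; near=> N.
  have px : p x = 0 by apply: contrapT => /eqP /pL.
  by rewrite /psi /a px mul0r subr0 expr1n subrr.
Unshelve. all: by end_near. Qed.

End bump_functions.

(** * Integrals of functions of bounded variation over translated sets *)

Section variation_of_translates.
Context {R : realType} {n : nat}.
Local Notation Rd := 'rV[R]_n.+1.
Local Notation mu := (@lebesgue R n).
Implicit Types (x y v c : Rd) (i : 'I_n.+1) (e r t s V : R) (u : Rd -> R)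
  (Omega X Y : set Rd).

(** The estimates on translations by less than [r] are made in this set, from
    which such translations do not leave [Omega]. *)
Definition inset Omega r : set Rd := [set x | ball x r `<=` Omega].

Lemma inset_sub Omega r : 0 < r -> inset Omega r `<=` Omega.
Proof. by move=> r0 x; apply; exact: ballxx. Qed.

Lemma closed_inset Omega r : 0 < r -> closed (inset Omega r).
Proof.
move=> r0; rewrite (_ : inset Omega r = ~` \bigcup_(y in ~` Omega) ball y r).
  by apply: open_closedC; apply: bigcup_open => y _; exact: ball_open.
apply/seteqP; split=> x; first by move=> xO [y /= yO yx]; apply: yO; apply: xO; exact: ball_sym.
move=> nx y xy; apply: contrapT => yO; apply: nx; exists y => //; exact: ball_sym.
Qed.

Lemma bounded_subset (A B : set Rd) : A `<=` B -> bounded_set B -> bounded_set A.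
Proof. by move=> AB [M [Mr HM]]; exists M; split => // x /HM h y /AB; exact: h. Qed.

Lemma compact_inset Omega r : 0 < r -> bounded_set Omega -> compact (inset Omega r).
Proof.
move=> r0 bO; apply: bounded_closed_compact; last exact: closed_inset.
exact: bounded_subset (inset_sub r0) bO.
Qed.

Lemma le_inset Omega r r' : 0 < r' <= r -> inset Omega r `<=` inset Omega r'.
Proof.
move=> /andP[r0 rr] x xO y /ball_coordP[_ xy]; apply: xO; apply/ball_coordP.
split; [exact: lt_le_trans rr|move=> i; exact: lt_le_trans (xy i) rr].
Qed.

Lemma ball_axis x i s r : `|s| < r -> ball x r (x + s *: ebasis i).
Proof.
move=> sr; apply/ball_coordP; split; first exact: le_lt_trans sr.
move=> j; rewrite !mxE eqxx /= opprD addrA subrr sub0r normrN normrM.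
by case: eqP => _; rewrite ?normr1 ?normr0 ?mulr1 ?mulr0 ?(le_lt_trans _ sr).
Qed.

Lemma inset_axis Omega x i s r r' : 0 < r' -> r' + `|s| <= r -> inset Omega r x ->
  inset Omega r' (x + s *: ebasis i).
Proof.
move=> r0 rr xO y /ball_coordP[_ xy]; apply: xO; apply/ball_coordP; split.
  by apply: lt_le_trans rr; rewrite ltr_wpDr.
move=> j; have sa : `|(s *: ebasis i : Rd) ord0 j| <= `|s|.
  by rewrite !mxE eqxx /= normrM; case: eqP => _; rewrite ?normr1 ?normr0 ?mulr1 ?mulr0.
have := xy j; rewrite [in X in X -> _]mxE; move: sa; move: ((s *: _ : Rd) ord0 j) => a sa xa.
rewrite (_ : _ - _ = (x ord0 j + a - y ord0 j) - a); last by ring.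
by rewrite (le_lt_trans (ler_normB _ _))//; lra.
Qed.

Lemma measurable_setY X Y : measurable X -> measurable Y -> measurable (X `+` Y).
Proof.
move=> mX mY; rewrite setYE; apply: measurableD; first exact: measurableU.
exact: measurableI.
Qed.

Lemma Rintegral_indic Omega X u : X `<=` Omega ->
  \int[mu]_(x in X) u x = \int[mu]_(x in Omega) (u x * \1_X x).
Proof.
move=> XO; rewrite -[in LHS](setIidr XO) Rintegral_mkcondr; apply: eq_Rintegral => x _.
by rewrite patchE indicE; case: ifP => _; rewrite ?mulr1 ?mulr0.
Qed.

Lemma indic_le1 X x : `|\1_X x : R| <= 1.
Proof. by rewrite indicE; case: (_ \in _); rewrite ?normr1 ?normr0 ?ler01. Qed.

Lemma Rintegral_setY Omega X Y u : measurable Omega -> measurable X -> measurable Y ->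
  X `<=` Omega -> Y `<=` Omega -> mu.-integrable Omega (EFin \o u) ->
  `|\int[mu]_(x in X) u x - \int[mu]_(x in Y) u x| <=
  \int[mu]_(x in X `+` Y) `|u x|.
Proof.
move=> mO mX mY XO YO iu; rewrite !(Rintegral_indic _ XO) !(Rintegral_indic _ YO).
have int Z : measurable Z -> mu.-integrable Omega (EFin \o (fun x => u x * \1_Z x)).
  move=> mZ; apply: (integrable_mul_bounded mO iu); first exact: measurable_indic.
  by exists 1 => x; exact: indic_le1.
rewrite -RintegralB//; [|exact: int|exact: int].
have iXY : mu.-integrable Omega (EFin \o (fun x => u x * \1_X x - u x * \1_Y x)).
  have := integrableB mO (int _ mX) (int _ mY); congr (_.-integrable _ _).
apply: (le_trans (le_normr_Rintegral mO iXY)).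
have XYO : X `+` Y `<=` Omega by move=> x; rewrite setYE => -[[/XO|/YO]].
rewrite (Rintegral_indic _ XYO) le_eqVlt; apply/orP; left; apply/eqP.
apply: eq_Rintegral => x _; rewrite -mulrBr normrM; congr (_ * _).
rewrite !indicE setYE in_setD in_setU in_setI.
by case: (_ \in _); case: (_ \in _) => //=; rewrite ?subrr ?normr0 ?subr0 ?sub0r ?normrN ?normr1.
Qed.

Lemma Rintegral_cvg_bounded Omega u (psi : nat -> Rd -> R) (f : Rd -> R) :
  measurable Omega -> mu.-integrable Omega (EFin \o u) ->
  (forall N, measurable_fun setT (psi N)) -> (forall N x, `|psi N x| <= 1) ->
  (forall x, psi N x @[N --> \oo] --> f x) -> measurable_fun setT f ->
  \int[mu]_(x in Omega) (u x * psi N x) @[N --> \oo] --> \int[mu]_(x in Omega) (u x * f x).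
Proof.
move=> mO iu mpsi psi1 psif mf.
have intN N : mu.-integrable Omega (EFin \o (fun x => u x * psi N x)).
  by apply: (integrable_mul_bounded mO iu (mpsi N)); exists 1 => x; exact: psi1.
have f1 x : `|f x| <= 1.
  apply: (@closed_cvg _ _ \oo _ (fun N => `|psi N x|) [set z : R | z <= 1] (@closed_le R 1)).
    by near=> N; exact: psi1.
  by apply: cvg_norm; exact: psif.
have intf : mu.-integrable Omega (EFin \o (fun x => u x * f x)).
  by apply: (integrable_mul_bounded mO iu mf); exists 1 => x; exact: f1.
apply: fine_cvg; rewrite fineK; last exact: integrable_fin_num.
apply: (@dominated_cvg _ _ _ mu _ mO (fun N x => (u x * psi N x)%:E) (fun x => (u x * f x)%:E) (fun x => `|u x|%:E)).
- by move=> N; exact: measurable_int (intN N).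
- move=> x _; apply: cvg_EFin; first by near=> N.
  by apply: cvgM; [exact: cvg_cst|exact: psif].
- by [].
- exact: integrable_norm iu.
- by move=> N x _; rewrite /= lee_fin normrM ler_piMr.
Unshelve. all: by end_near. Qed.

(** The case of a test function passes to the limit by dominated convergence. *)
Lemma variation_ball_union_shift Omega u i (V t : R) (L : seq (Rd * R)) (C : set Rd) :
  measurable Omega -> mu.-integrable Omega (EFin \o u) ->
  (Defs.variation Omega u <= V%:E)%E -> 0 <= t ->
  (forall p, p \in L -> 0 < p.2) -> compact C -> ball_union L `<=` C ->
  (forall x s, C x -> 0 <= s <= t -> Omega (x + s *: ebasis i)) ->
  `|\int[mu]_(x in ball_union L) u x -
    \int[mu]_(x in translate (- (t *: ebasis i)) (ball_union L)) u x| <= V * t.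
Proof.
move=> mO iu uV t0 L0 cC LC CO.
have [psi [Cpsi psi1 spsi psiL]] := ball_union_approx L0 cC LC.
have LO : ball_union L `<=` Omega.
  by move=> x /LC Cx; have := CO x 0 Cx; rewrite scale0r addr0; apply; rewrite lexx.
have LO' : translate (- (t *: ebasis i)) (ball_union L) `<=` Omega.
  move=> x /LC Cx; have := CO _ t Cx; rewrite subrK; apply; rewrite lexx t0//.
have mL : measurable (ball_union L) by apply: open_measurable_Rd; exact: open_ball_union.
have mL' : measurable (translate (- (t *: ebasis i)) (ball_union L)) by exact: measurable_translate.
rewrite (Rintegral_indic _ LO) (Rintegral_indic _ LO').
pose D N := `|\int[mu]_(x in Omega) (u x * psi N x) -
  \int[mu]_(x in Omega) (u x * psi N (x - t *: ebasis i))|.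
have DV N : D N <= V * t.
  apply: variation_test_shift => // x s /spsi; exact: CO.
have mpsi N : measurable_fun setT (psi N) by apply: continuous_measurable_Rd; exact: C1c_continuous.
have mpsi' N : measurable_fun setT (fun x => psi N (x - t *: ebasis i)).
  apply: continuous_measurable_Rd; apply: C1c_continuous; exact: (C1c_shift (- (t *: ebasis i)) (Cpsi N)).
apply: (@closed_cvg _ _ \oo _ D [set z : R | z <= V * t] (@closed_le R _)).
  by near=> N; exact: DV.
apply: cvg_norm; apply: cvgB.
  by apply: Rintegral_cvg_bounded => //; exact: measurable_indic.
by apply: Rintegral_cvg_bounded => //.
Unshelve. all: by end_near. Qed.

Lemma compact_ball_union (K W : set Rd) : compact K -> open W -> K `<=` W ->
  exists L : seq (Rd * R), [/\ forall p, p \in L -> 0 < p.2, K `<=` ball_union L &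
    ball_union L `<=` W].
Proof.
move=> cK oW KW; move: cK; rewrite compact_cover => cK.
pose D := [set p : Rd * R | 0 < p.2 /\ eball p.1 p.2 `<=` W].
have [|D' D'D KD'] := cK _ D (fun p => eball p.1 p.2) (fun p _ => @open_eball R n p.1 p.2).
  move=> x /KW Wx; have /nbhs_ballP[e /= e0 eW] : nbhs x W by exact: open_nbhs_nbhs.
  exists (x, e); last exact: eball_center.
  split=> // y xy; apply: eW; apply/ball_coordP; split=> // j; rewrite distrC.
  by apply: le_lt_trans xy; have := coord_le_enorm (y - x) j; rewrite !mxE.
exists (finmap.enum_fset D'); split.
- by move=> p pD'; have /set_mem[] := D'D p pD'.
- by move=> x /KD'[p pD' px]; exists p.
- by move=> x [p pD' px]; have /set_mem[_] := D'D p pD'; exact.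
Qed.

Lemma dist_perturb (a b c d e v : R) : `|a - c| < e / 2 -> `|b - d| < e / 2 ->
  `|c - d| <= v -> `|a - b| <= v + e.
Proof.
rewrite !ler_norml !ltr_norml => /andP[? ?] /andP[? ?] /andP[? ?].
by apply/andP; split; lra.
Qed.

(** A measurable set differs from a finite union of balls by a set of small
    measure, on which [u] has a small integral by absolute continuity. *)
Lemma variation_set_shift Omega u i (V t r : R) X :
  open Omega -> bounded_set Omega -> mu.-integrable Omega (EFin \o u) ->
  (Defs.variation Omega u <= V%:E)%E -> 0 <= t -> t < r ->
  measurable X -> X `<=` inset Omega r ->
  `|\int[mu]_(x in X) u x -
    \int[mu]_(x in translate (- (t *: ebasis i)) X) u x| <= V * t.
Proof.
move=> oO bO iu uV t0 tr mX Xr; have mO := open_measurable_Rd oO.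
have r0 : 0 < r by exact: le_lt_trans tr.
have XO : X `<=` Omega := subset_trans Xr (inset_sub r0).
(* The balls may exceed X by r - r', and can still be translated by t < r'. *)
pose r' := (t + r) / 2; have [r'0 tr' rr'] : [/\ 0 < r', t < r' & r' < r].
  by rewrite /r'; split; lra.
pose W := \bigcup_(x in X) ball x (r - r').
have oW : open W by apply: bigcup_open => x _; exact: ball_open.
have XW : X `<=` W by move=> x Xx; exists x => //; apply: ballxx; rewrite subr_gt0.
have WC : W `<=` inset Omega r'.
  move=> y [x Xx xy] z yz; apply: (Xr x Xx).
  by have := ball_triangle xy yz; rewrite subrK.
have CO x s : inset Omega r' x -> 0 <= s <= t -> Omega (x + s *: ebasis i).
  move=> xC /andP[s0 st]; apply: xC; apply: ball_axis.
  by rewrite ger0_norm// (le_lt_trans st).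
have translateO Y : Y `<=` inset Omega r' -> translate (- (t *: ebasis i)) Y `<=` Omega.
  by move=> YC x /YC Cx; have := CO _ t Cx; rewrite subrK; apply; rewrite t0 lexx.
apply/ler_addgt0Pr => eta eta0.
have eta2 : 0 < eta / 2 by rewrite divr_gt0.
have iw : mu.-integrable setT (EFin \o (u \_ Omega)).
  by rewrite -restrict_EFin; apply/(integrable_mkcond _ mO).
have [d [d0 dP]] := integral_normr_continuous iw eta2.
have small A : measurable A -> A `<=` Omega -> (mu A < d%:E)%E -> \int[mu]_(x in A) `|u x| < eta / 2.
  move=> mA AO Ad; have := dP A mA Ad; congr (_ < _); apply: eq_Rintegral => x /set_mem Ax.
  by rewrite patchE mem_set//; exact: AO.
have d4 : 0 < d / 4 by rewrite divr_gt0.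
have bX : bounded_set X := bounded_subset XO bO.
have Xoo : (mu X < +oo)%E by exact: bounded_lebesgue_lty.
have [K [clK KX XK]] := lebesgue_inner_regular d4 mX bX.
have [U0 [oU0 XU0 U0X]] := lebesgue_outer_regular d4 Xoo.
have cK : compact K by apply: bounded_closed_compact => //; exact: bounded_subset bX.
have [L [L0 KL LUW]] := compact_ball_union cK (openI oU0 oW) (fun x Kx => conj (XU0 _ (KX _ Kx)) (XW _ (KX _ Kx))).
pose U := ball_union L.
have oU : open U by exact: open_ball_union.
have mU := open_measurable_Rd oU.
have UC : U `<=` inset Omega r' by move=> x /LUW[_ /WC].
have UO : U `<=` Omega := subset_trans UC (inset_sub r'0).
have UX : (mu (X `+` U) < d%:E)%E.
  apply: (@le_lt_trans _ _ (mu (X `\` K `|` (U0 `\` X)))).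
    apply: le_outer_measure => x; rewrite setYE => -[[Xx|Ux] nXU].
      by left; split => // Kx; apply: nXU; split => //; exact: KL.
    have [Xx|Xx] := pselect (X x); first by exfalso; apply: nXU.
    by right; split => //; have [] := LUW _ Ux.
  apply: (@le_lt_trans _ _ ((d / 4)%:E + (d / 4)%:E)%E).
    apply: le_trans (measureU2 _ _ _) _; [apply: measurableD => //; exact: closed_measurable_Rd|by apply: measurableD => //; exact: open_measurable_Rd|].
    apply: leeD => //; have mU0 := open_measurable_Rd oU0.
    rewrite measureD//; last by rewrite (le_lt_trans U0X)// lte_add_pinfty// ltry.
    by rewrite (setIidr XU0) leeBlDl// ge0_fin_numE.
  by rewrite -EFinD lte_fin; lra.
have XC : X `<=` inset Omega r' by exact: subset_trans WC.
have mtX : measurable (translate (- (t *: ebasis i)) X) by exact: measurable_translate.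
have mtU : measurable (translate (- (t *: ebasis i)) U) by exact: measurable_translate.
have YO A B : A `<=` Omega -> B `<=` Omega -> A `+` B `<=` Omega.
  by move=> AO BO x; rewrite setYE => -[[/AO|/BO]].
have h1 : `|\int[mu]_(x in X) u x - \int[mu]_(x in U) u x| < eta / 2.
  apply: le_lt_trans (Rintegral_setY mO mX mU XO UO iu) _.
  by apply: small => //; [exact: measurable_setY|exact: YO].
have h2 : `|\int[mu]_(x in translate (- (t *: ebasis i)) X) u x -
            \int[mu]_(x in translate (- (t *: ebasis i)) U) u x| < eta / 2.
  apply: le_lt_trans (Rintegral_setY mO mtX mtU (translateO _ XC) (translateO _ UC) iu) _.
  apply: small; [exact: measurable_setY|by apply: YO; exact: translateO|].
  by rewrite -(lebesgue_translate (- (t *: ebasis i))) in UX; exact: UX.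
have h3 := variation_ball_union_shift (i := i) mO iu uV t0 L0 (compact_inset r'0 bO) UC CO.
exact: dist_perturb h1 h2 h3.
Qed.

End variation_of_translates.

(** * The perimeter controls translations *)

Section translates_of_almost_minimal_sets.
Context {R : realType} {n : nat}.
Local Notation Rd := 'rV[R]_n.+1.
Local Notation mu := (@lebesgue R n).
Implicit Types (x y v : Rd) (i : 'I_n.+1) (e r t s V : R) (u rho : Rd -> R)
  (Omega X Y T A B : set Rd).

Lemma lebesgueU_le X Y : (mu (X `|` Y) <= mu X + mu Y)%E.
Proof. exact: outer_measureU2. Qed.

Lemma lebesgue_fine Omega X : bounded_set Omega -> X `<=` Omega -> mu X = (fine (mu X))%:E.
Proof.
move=> bO XO; rewrite fineK// ge0_fin_numE//; apply: bounded_lebesgue_lty.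
exact: bounded_subset XO bO.
Qed.

Lemma ae_Rintegral_ge0 X u : measurable X -> measurable_fun X u ->
  (\forall x \ae mu, X x -> 0 <= u x) -> 0 <= \int[mu]_(x in X) u x.
Proof.
move=> mX mu' u0; apply: fine_ge0; apply: (ae_integral_ge0 mX) => //.
exact/measurable_EFinP.
Qed.

Lemma le_Rintegral_null Omega X T rho : measurable Omega -> measurable X -> measurable T ->
  X `<=` Omega -> T `<=` Omega -> mu.-integrable Omega (EFin \o rho) ->
  (\forall x \ae mu, Omega x -> 0 <= rho x) -> mu (X `\` T) = 0%E ->
  \int[mu]_(x in X) rho x <= \int[mu]_(x in T) rho x.
Proof.
move=> mO mX mT XO TO irho rho0 XT0.
rewrite (Rintegral_indic _ XO) (Rintegral_indic _ TO) -subr_ge0.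
have int Z : measurable Z -> mu.-integrable Omega (EFin \o (fun x => rho x * \1_Z x)).
  move=> mZ; apply: (integrable_mul_bounded mO irho); first exact: measurable_indic.
  by exists 1 => x; exact: indic_le1.
rewrite -RintegralB//; [|exact: int|exact: int].
apply: (ae_Rintegral_ge0 (X := Omega) mO).
  by apply: measurable_funB; apply/measurable_EFinP; [exact: measurable_int (int _ mT)|exact: measurable_int (int _ mX)].
have nXT : \forall x \ae mu, ~ (X `\` T) x.
  by apply/lebesgue0_negligible; rewrite (_ : ~` _ = X `\` T)//; apply/seteqP; split=> x /=; [move=> /contrapT|move=> h; exact].
apply: filterS2 rho0 nXT => x rho0 nx Ox; rewrite -mulrBr mulr_ge0 ?rho0//.
rewrite subr_ge0 !indicE; have [Xx|Xx] := boolP (x \in X); last by case: (_ \in _).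
rewrite mem_set//; apply: contrapT => Tx; apply: nx; split => //; exact: set_mem.
Qed.

Lemma lower_density_bound Omega X (rho0 rho1 : Rd -> R) (c : R) :
  bounded_set Omega -> measurable Omega -> measurable X -> X `<=` Omega ->
  mu.-integrable Omega (EFin \o rho0) -> mu.-integrable Omega (EFin \o rho1) ->
  (\forall x \ae mu, Omega x -> c <= rho0 x + rho1 x) ->
  c * fine (mu X) <= \int[mu]_(x in X) rho0 x + \int[mu]_(x in X) rho1 x.
Proof.
move=> bO mO mX XO i0 i1 rc.
have i0' : mu.-integrable X (EFin \o rho0) by exact: integrableS i0.
have i1' : mu.-integrable X (EFin \o rho1) by exact: integrableS i1.
have i01 : mu.-integrable X (EFin \o (fun x => rho0 x + rho1 x)).
  by have := integrableD mX i0' i1'; congr (_.-integrable _ _).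
have Xoo : (mu X < +oo)%E by rewrite (lebesgue_fine bO XO) ltry.
have ic : mu.-integrable X (EFin \o cst c).
  apply: measurable_bounded_integrable => //; exists `|c|.
  by split; [exact: num_real|move=> y /ltW cy x _].
rewrite -RintegralD// -(Rintegral_cst mu mX c) -subr_ge0 -RintegralB//.
apply: (ae_Rintegral_ge0 mX).
  by apply: measurable_funB; apply/measurable_EFinP; [exact: measurable_int i01|exact: measurable_int ic].
by apply: filterS rc => x rc /XO /rc; rewrite subr_ge0.
Qed.

Definition axis_shift A i t : set Rd := translate (t *: ebasis i) A.

Lemma eball_axis x i s r : `|s| < r -> eball (x + s *: ebasis i) r x.
Proof.
move=> sr; rewrite /eball /= /enorm (bigD1 i)//= big1 => [|j /negbTE ji].
  rewrite !mxE !eqxx /= mulr1 opprD addrA subrr sub0r sqrrN addr0.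
  by rewrite sqrtr_sqr.
by rewrite !mxE ji mulr0 addr0 subrr expr0n.
Qed.

(** The point [x + s *: ebasis i] of [A] lies in the ball of radius [e] around [x],
    and unless it is in an exceptional null set, it makes that ball meet [A] in
    positive measure. *)
Lemma near_set_layer Omega A i s e X : A `<=` Omega -> `|s| < e ->
  (forall x, X x -> Omega x /\ ~ A x /\ A (x + s *: ebasis i)) ->
  mu (X `\` outer_layer Omega A e) = 0%E.
Proof.
move=> AO se XA.
apply: (@sub_lebesgue0 _ _ _ (translate (s *: ebasis i) (A `\` positive_part A))).
  move=> x [/XA[Ox [nAx Ax]] nx]; split => // pA; apply: nx; split => //=.
  by apply/eball_pos; exists (x + s *: ebasis i) => //; exact: eball_axis.
by rewrite lebesgue_translate positive_part_ae.
Qed.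

Lemma near_compl_layer Omega A i s e X : `|s| < e ->
  (forall x, X x -> A x /\ Omega (x + s *: ebasis i) /\ ~ A (x + s *: ebasis i)) ->
  mu (X `\` inner_layer Omega A e) = 0%E.
Proof.
move=> se XA; set B := Omega `\` A.
apply: (@sub_lebesgue0 _ _ _ (translate (s *: ebasis i) (B `\` positive_part B))).
  move=> x [/XA[Ax [Ox nAx]] nx]; split => // pA; apply: nx; split => //=.
  by apply/eball_pos; exists (x + s *: ebasis i) => //; exact: eball_axis.
by rewrite lebesgue_translate positive_part_ae.
Qed.

Lemma layer_arith (c a b e M V t p0 p1 p1' m0 m1 m0' : R) : V * t <= V * e ->
  `|p1 - p1'| <= V * t -> `|m0 - m0'| <= V * t ->
  c * a <= p0 + p1 -> c * b <= m0 + m1 ->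
  p0 <= e * M -> m1 <= e * M -> m0' <= e * M -> p1' <= e * M ->
  c * (a + b) <= (4 * M + 2 * V) * e.
Proof.
rewrite !ler_norml => ? /andP[? ?] /andP[? ?] ? ? ? ? ? ?; lra.
Qed.

Section density.
Variables (Omega : set Rd) (rho0 rho1 : Rd -> R) (c V : R).
Hypothesis V_ge0 : 0 <= V.
Hypotheses (oO : open Omega) (bO : bounded_set Omega).
Hypotheses (i0 : mu.-integrable Omega (EFin \o rho0)) (V0 : (Defs.variation Omega rho0 <= V%:E)%E).
Hypotheses (i1 : mu.-integrable Omega (EFin \o rho1)) (V1 : (Defs.variation Omega rho1 <= V%:E)%E).
Hypotheses (r0 : \forall x \ae mu, Omega x -> 0 <= rho0 x).
Hypotheses (r1 : \forall x \ae mu, Omega x -> 0 <= rho1 x).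
Hypotheses (c0 : 0 < c) (rc : \forall x \ae mu, Omega x -> c <= rho0 x + rho1 x).

(** Let [Xp] be the set of points outside [A] that the translation brings into [A].
    Up to a null set, it lies in the outer layer, where the integral of [rho0] is
    small, and its image under the translation in the inner layer, where the
    integral of [rho1] is small. As [rho1] has bounded variation, its integral over [Xp] is then
    small too, and [rho0 + rho1 >= c] bounds the measure of [Xp]. For the set [Xm] of
    points that leave [A], the roles of [rho0] and [rho1] are exchanged. *)
Lemma Per_axis_shift A e M i t r : measurable A -> A `<=` Omega -> 0 < e ->
  (Per Omega rho0 rho1 e A <= M%:E)%E -> 0 < t -> t < e -> t < r ->
  (mu (inset Omega r `&` (A `+` axis_shift A i t)) <=
     ((4 * M + 2 * V) / c * e)%:E)%E.
Proof.
move=> mA AO e0 PerM t0 te tr; have mO := open_measurable_Rd oO.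
have r00 : 0 < r := lt_trans t0 tr.
have m0 : measurable_fun Omega rho0 by apply/measurable_EFinP; exact: measurable_int i0.
have m1 : measurable_fun Omega rho1 by apply/measurable_EFinP; exact: measurable_int i1.
have [P0 P1] := Per_layers oO mA AO e0 m0 m1 r0 r1 PerM.
have mT := measurable_outer_layer e mO mA; have mS := measurable_inner_layer e mO mA.
have TO : outer_layer Omega A e `<=` Omega by move=> x [[]].
have SO : inner_layer Omega A e `<=` Omega by move=> x [/AO].
have {}P0 : \int[mu]_(x in outer_layer Omega A e) rho0 x <= e * M.
  by rewrite -lee_fin /Rintegral fineK//; apply: integrable_fin_num => //; exact: integrableS i0.
have {}P1 : \int[mu]_(x in inner_layer Omega A e) rho1 x <= e * M.
  by rewrite -lee_fin /Rintegral fineK//; apply: integrable_fin_num => //; exact: integrableS i1.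
have tn : `|t| < e by rewrite gtr0_norm.
have tn' : `|- t| < e by rewrite normrN gtr0_norm.
have mI : measurable (inset Omega r) by apply: closed_measurable_Rd; exact: closed_inset.
have mtA : measurable (axis_shift A i t) by exact: measurable_translate.
pose Xp := inset Omega r `&` (axis_shift A i t `\` A).
pose Xm := inset Omega r `&` (A `\` axis_shift A i t).
have mXp : measurable Xp by apply: measurableI => //; exact: measurableD.
have mXm : measurable Xm by apply: measurableI => //; exact: measurableD.
have Xpr : Xp `<=` inset Omega r by move=> x [].
have Xmr : Xm `<=` inset Omega r by move=> x [].
have IO := inset_sub r00 : inset Omega r `<=` Omega.
have XpO := subset_trans Xpr IO; have XmO := subset_trans Xmr IO.
have axO x : inset Omega r x -> Omega (x + t *: ebasis i).
  by move=> xO; apply: xO; apply: ball_axis; rewrite gtr0_norm.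
pose Xp' := translate (- (t *: ebasis i)) Xp; pose Xm' := translate (- (t *: ebasis i)) Xm.
have mXp' : measurable Xp' by exact: measurable_translate.
have mXm' : measurable Xm' by exact: measurable_translate.
have Xp'O : Xp' `<=` Omega by move=> x [/axO]; rewrite subrK.
have Xm'O : Xm' `<=` Omega by move=> x [/axO]; rewrite subrK.
have hp0 : \int[mu]_(x in Xp) rho0 x <= e * M.
  apply: le_trans P0; apply: (le_Rintegral_null mO) => //.
  by apply: (near_set_layer (i := i) AO tn) => x [/IO Ox [Ax nAx]].
have hm1 : \int[mu]_(x in Xm) rho1 x <= e * M.
  apply: le_trans P1; apply: (le_Rintegral_null mO) => //.
  by apply: (near_compl_layer (i := i) tn) => x [/axO Ox [Ax nAx]].
have hm0 : \int[mu]_(x in Xm') rho0 x <= e * M.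
  apply: le_trans P0; apply: (le_Rintegral_null mO) => //.
  apply: (near_set_layer (i := i) AO tn') => x Xx; split; first exact: Xm'O.
  case: Xx => _ [Ax nAx]; rewrite scaleNr; split => // Ax'; apply: nAx.
  by rewrite /axis_shift /translate /= subrK.
have hp1 : \int[mu]_(x in Xp') rho1 x <= e * M.
  apply: le_trans P1; apply: (le_Rintegral_null mO) => //.
  apply: (near_compl_layer (i := i) tn') => x [/IO Ox [Ax nAx]]; rewrite scaleNr; split => //.
  by move: Ax; rewrite /axis_shift /translate /= subrK.
have vp := variation_set_shift i oO bO i1 V1 (ltW t0) tr mXp Xpr.
have vm := variation_set_shift i oO bO i0 V0 (ltW t0) tr mXm Xmr.
have cp := lower_density_bound bO mO mXp XpO i0 i1 rc.
have cm := lower_density_bound bO mO mXm XmO i0 i1 rc.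
apply: (@le_trans _ _ (mu Xp + mu Xm)%E).
  apply: le_trans (lebesgueU_le _ _); apply: le_outer_measure => x [Ix].
  by rewrite setY_def => -[[Ax nAx]|[Ax nAx]]; [right|left].
rewrite (lebesgue_fine bO XpO) (lebesgue_fine bO XmO) -EFinD lee_fin.
rewrite mulrAC ler_pdivlMr// mulrC.
have Vte : V * t <= V * e by rewrite ler_wpM2l// ltW.
rewrite -/Xp' -/Xm' in vp vm.
exact: layer_arith Vte vp vm cp cm hp0 hm1 hm0 hp1.
Qed.

End density.

Section small_shifts.
Variable Omega : set Rd.

Definition small_shifts A e (C : R) := forall i t r, 0 < t -> t < e -> t < r ->
  (mu (inset Omega r `&` (A `+` axis_shift A i t)) <= (C * e)%:E)%E.

Lemma axis_shiftD A i s t : axis_shift (axis_shift A i s) i t = axis_shift A i (s + t).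
Proof.
by apply/seteqP; split=> x; rewrite /axis_shift /translate /= -addrA -scalerDl addrC [t + s]addrC addrC.
Qed.

Lemma setY_triangle A B D : A `+` D `<=` (A `+` B) `|` (B `+` D).
Proof.
move=> x; rewrite !setY_def => -[[Ax Dx]|[Dx Ax]]; have [Bx|Bx] := pselect (B x).
- by right; left.
- by left; left.
- by left; right.
- by right; right.
Qed.

(** Translating the whole configuration back costs [`|s|] in the distance to the
    complement of [Omega']. *)
Lemma shift_inset Omega' A B i s r r' : 0 < r' -> r' + `|s| <= r ->
  (mu (inset Omega' r `&` (axis_shift A i s `+` axis_shift B i s)) <=
   mu (inset Omega' r' `&` (A `+` B)))%E.
Proof.
move=> r'0 rr; rewrite -[leRHS](lebesgue_translate (s *: ebasis i)).
apply: le_outer_measure => x [Ox ABx]; split=> //; exact: inset_axis rr Ox.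
Qed.

(** The translation is decomposed into steps shorter than [e]. The comparison made
    after some steps is a translate of the comparison made at the start. *)
Lemma shift_chain A e C i t (k : nat) r : small_shifts A e C ->
  0 < t -> t < e -> k.+1%:R * t < r ->
  (mu (inset Omega r `&` (A `+` axis_shift A i (k.+1%:R * t))) <= (k.+1%:R * (C * e))%:E)%E.
Proof.
move=> sA t0 te; elim: k r => [|k IH] r tr; first by rewrite !mul1r in tr *; exact: sA.
have E : k.+2%:R * t = k.+1%:R * t + t by rewrite -[k.+2%:R]natr1 mulrDl mul1r.
have kt0 : 0 < k.+1%:R * t by rewrite mulr_gt0.
rewrite E -axis_shiftD.
apply: (@le_trans _ _ ((C * e)%:E + (k.+1%:R * (C * e))%:E)%E); last first.
  by rewrite -EFinD lee_fin -[k.+2%:R]natr1 mulrDl mul1r addrC.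
apply: (@le_trans _ _ (mu (inset Omega r `&` (A `+` axis_shift A i t)) +
   mu (inset Omega r `&` (axis_shift A i t `+` axis_shift (axis_shift A i (k.+1%:R * t)) i t)))%E).
  apply: le_trans (lebesgueU_le _ _); apply: le_outer_measure => x [Ox].
  by move=> /(setY_triangle (axis_shift A i t))[?|?]; [left|right].
apply: leeD; first by apply: sA => //; lra.
apply: (@le_trans _ _ (mu (inset Omega (r - t) `&` (A `+` axis_shift A i (k.+1%:R * t))))).
  by apply: shift_inset; rewrite ?gtr0_norm//; lra.
by apply: IH; lra.
Qed.

Lemma shift_pos A e C i t r : 0 <= C -> 0 < e -> small_shifts A e C -> 0 <= t -> t < r ->
  (mu (inset Omega r `&` (A `+` axis_shift A i t)) <= (C * (t + e))%:E)%E.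
Proof.
move=> C0 e0 sA; rewrite le_eqVlt => /orP[/eqP <- r_gt0|t0 tr].
  rewrite /axis_shift scale0r (_ : translate 0 A = A); last first.
    by apply/seteqP; split=> x; rewrite /translate /= addr0.
  rewrite setYK setI0; have -> : mu set0 = 0%E by exact: measure0.
  by rewrite lee_fin mulr_ge0// add0r ltW.
pose k := Num.truncn (t / e).
have te0 : 0 <= t / e by rewrite divr_ge0 ?ltW.
have /andP[k1 k2] : k%:R <= t / e < k.+1%:R by exact: truncn_itv.
have k0 : k.+1%:R != 0 :> R by rewrite pnatr_eq0.
have tE : t = k.+1%:R * (t / k.+1%:R) by rewrite mulrCA divff// mulr1.
rewrite {1}tE; apply: le_trans (shift_chain _ sA _ _ _) _.
- by rewrite divr_gt0.
- by rewrite ltr_pdivrMr// mulrC -ltr_pdivrMr.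
- by rewrite -tE.
rewrite lee_fin mulrCA ler_wpM2l// -natr1 mulrDl mul1r lerD2r.
by rewrite -ler_pdivlMr.
Qed.

(** The factor [2] leaves the room needed to read a translation by [t < 0] as the
    translation by [- t] of an already translated set. *)
Definition shift_bound (C e : R) A := forall i t r, 2 * `|t| < r ->
  (mu (inset Omega r `&` (A `+` axis_shift A i t)) <= (C * (`|t| + e))%:E)%E.

Lemma small_shifts_bound A e C : 0 <= C -> 0 < e -> small_shifts A e C -> shift_bound C e A.
Proof.
move=> C0 e0 sA i t r; have [t0 tr|t0 tr] := leP 0 t.
  by rewrite ger0_norm// in tr *; apply: shift_pos => //; lra.
rewrite ltr0_norm// in tr *.
have AE : A = axis_shift (axis_shift A i (- t)) i t.
  rewrite axis_shiftD addNr /axis_shift scale0r.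
  by apply/seteqP; split=> x; rewrite /translate /= addr0.
apply: (@le_trans _ _ (mu (inset Omega (r + t) `&` (axis_shift A i (- t) `+` A)))%E).
  rewrite {1}AE; apply: shift_inset; rewrite ?ltr0_norm//; lra.
rewrite setYC; apply: shift_pos => //; lra.
Qed.

End small_shifts.

End translates_of_almost_minimal_sets.

(** * Merging the cells of a grid in one direction *)

Section grids.
Context {R : realType} {n : nat}.
Local Notation Rd := 'rV[R]_n.+1.
Local Notation mu := (@lebesgue R n).
Implicit Types (x y v : Rd) (i : 'I_n.+1) (e r t s : R)
  (Omega X Y A B D U : set Rd) (l : 'I_n.+1 -> R).

(** Cells are encoded by the integer parts of the rescaled coordinates, so that a
    union of cells is a set closed under [same_cell]. *)
Definition same_cell l x y := forall j,
  Num.floor (x ord0 j / l j) = Num.floor (y ord0 j / l j).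

Definition gridset l U := forall x y, same_cell l x y -> U x -> U y.

Lemma floor_div (z : R) (N : nat) : (0 < N)%N ->
  Num.floor (z / N%:R) = (Num.floor z %/ N%:Z)%Z.
Proof.
move=> N0; apply: floor_def; have N1 : 0 < N%:R :> R by rewrite ltr0n.
have /andP[z1 z2] := floor_itv z; set m := Num.floor z in z1 z2 *.
have E := divz_eq m N%:Z; have r0 : (0 <= m %% N%:Z)%Z by apply: modz_ge0; rewrite eqz_nat -lt0n.
have r1 : (m %% N%:Z < N%:Z)%Z by exact: ltz_pmod.
rewrite ler_pdivlMr// ltr_pdivrMr//; apply/andP; split.
  by apply: le_trans z1; rewrite -[N%:R]/(N%:Z%:~R) -intrM ler_int {2}E lerDl.
apply: lt_le_trans z2 _; rewrite -[N%:R]/(N%:Z%:~R) -intrM ler_int.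
by rewrite mulrDl mul1r {1}E -addrA lerD2l lezD1.
Qed.

(** The cells whose index in direction [i] is [c] modulo [N], when [N] consecutive
    cells are about to be merged. *)
Definition column (h : R) (N : nat) i (c : nat) : set Rd :=
  [set x | (Num.floor (x ord0 i / h) %% N%:Z)%Z = c%:Z].

Lemma measurable_floor_slab h i (z : int) : 0 < h ->
  measurable [set x : Rd | Num.floor (x ord0 i / h) = z].
Proof.
move=> h0.
pose S (a : R) : set Rd := [set x | a <= x ord0 i].
pose T : set Rd := [set x | Num.floor (x ord0 i / h) = z].
have E : T = S (z%:~R * h) `&` ~` S ((z + 1)%:~R * h).
  apply/seteqP; split=> x.
    rewrite /T /= => /eqP; rewrite floor_eq ler_pdivlMr// ltr_pdivrMr// => /andP[h1 h2].
    by split; [exact: h1|rewrite /S /=; apply/negP; rewrite -ltNge].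
  rewrite /S /T /= => -[h1 /negP]; rewrite -ltNge => h2; apply/eqP.
  by rewrite floor_eq ler_pdivlMr// ltr_pdivrMr// h1.
have mge a : measurable (S a).
  by apply: closed_measurable_Rd; apply: (@closed_coord _ _ [set z | a <= z] i); exact: closed_ge.
by rewrite -[X in measurable X]/T E; apply: measurableI => //; exact: measurableC.
Qed.

Lemma measurable_column h N i c : 0 < h -> measurable (column h N i c).
Proof.
move=> h0; have -> : column h N i c = \bigcup_(z : int)
    if (z %% N%:Z)%Z == c%:Z then
      [set x | Num.floor (x ord0 i / h) = z] else set0.
  apply/seteqP; split=> x.
    by move=> xc; exists (Num.floor (x ord0 i / h)) => //; rewrite xc eqxx.
  by move=> [z _]; case: ifP => // /eqP zc /= xz; rewrite /column /= xz.
apply: countable_bigcupT_measurable => // z; case: ifP => _; last exact: measurable0.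
exact: measurable_floor_slab.
Qed.

Lemma trivIset_column h N i : trivIset setT (column h N i).
Proof.
apply/trivIsetP => a b _ _ ab; apply/seteqP; split=> x // [xa xb].
by move: ab; rewrite -eqz_nat -xa -xb eqxx.
Qed.

Lemma sum_column h N i X : 0 < h -> (mu X < +oo)%E ->
  \sum_(c < N) fine (mu (X `&` column h N i c)) <= fine (mu X).
Proof.
move=> h0 Xoo.
have Xfin Z : mu (X `&` Z) \is a fin_num.
  by rewrite ge0_fin_numE//; apply: le_lt_trans Xoo; apply: le_outer_measure; exact: subIsetl.
have Xf : mu X \is a fin_num by rewrite ge0_fin_numE.
rewrite -lee_fin fineK// -sumEFin.
under eq_bigr do rewrite fineK//.
have mc c : (@lebesgue_outer R n).-caratheodory (column h N i c) by exact: measurable_column.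
rewrite -(caratheodory_additive mc (@trivIset_column h N i) N X).
by apply: le_outer_measure; exact: subIsetl.
Qed.

Lemma exists_le_average (N : nat) (w : 'I_N -> R) (b : R) : (0 < N)%N ->
  \sum_j w j <= N%:R * b -> exists j, w j <= b.
Proof.
move=> N0 wb; apply: contrapT => nw.
have wj j : b < w j by rewrite ltNge; apply/negP => wjb; apply: nw; exists j.
move: wb; apply/negP; rewrite -ltNge.
have -> : N%:R * b = \sum_(j < N) b by rewrite sumr_const card_ord mulr_natl.
apply: ltr_sum => //; by rewrite has_predT -[index_enum _]enumT size_enum_ord.
Qed.

(** In [merge_columns], the translation from column [c] to column [j] has length
    [j - c] times the mesh. Adding [N.-1] makes these lengths natural numbers below
    [N + N], and distinct [j] give distinct lengths. *)
Lemma sum_shifted_le (N c : nat) (g : nat -> R) : (c < N)%N -> (forall m, 0 <= g m) ->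
  \sum_(j < N) g (j + (N.-1 - c))%N <= \sum_(m < N + N) g m.
Proof.
move=> cN g0; set s := (N.-1 - c)%N.
have sN : (s + N <= N + N)%N by rewrite leq_add2r /s; lia.
rewrite -(big_mkord xpredT g) (@big_cat_nat _ _ _ s)//=; last by apply: leq_trans sN; exact: leq_addr.
rewrite [X in _ + X](@big_cat_nat _ _ _ (s + N))//=; last exact: leq_addr.
have -> : \sum_(j < N) g (j + s)%N = \sum_(s <= j < s + N) g j.
  by rewrite -[X in \sum_(X <= _ < _) _]add0n big_addn addKn big_mkord.
rewrite addrCA lerDl addr_ge0//; apply: sumr_ge0 => //.
Qed.

Section merge.
Variables (Omega A U : set Rd) (l : 'I_n.+1 -> R) (i : 'I_n.+1) (N : nat).
Hypotheses (bO : bounded_set Omega) (N0 : (0 < N)%N) (l0 : forall j, 0 < l j).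
Hypothesis gU : gridset l U.

Let q x := (Num.floor (x ord0 i / l i) %% N%:Z)%Z.

Let qN x : exists2 c : 'I_N, q x = c%:Z & column (l i) N i c x.
Proof.
have q0 : 0 <= q x by apply: modz_ge0; rewrite eqz_nat -lt0n.
have qlt : q x < N%:Z by exact: ltz_pmod.
have cN : (`|q x|%N < N)%N by rewrite -ltz_nat gez0_abs.
by exists (Ordinal cN) => /=; rewrite ?/column /= gez0_abs.
Qed.

(** In every block of [N] consecutive cells, all the columns become copies of
    column [j]. *)
Definition merged (j : nat) : set Rd :=
  [set x | U (x + ((j%:Z - q x)%:~R * l i) *: ebasis i)].

Definition merged_mesh : 'I_n.+1 -> R := fun k => if k == i then N%:R * l i else l k.

Lemma gridset_merged j : gridset merged_mesh (merged j).
Proof.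
move=> x y xy; apply: gU => k; rewrite !mxE eqxx /=.
have [->|ki] := eqVneq k i; last first.
  by rewrite !mulr0 !addr0; have := xy k; rewrite /merged_mesh (negbTE ki).
rewrite !mulr1 !mulrDl !mulfK ?gt_eqF// !floorDrz ?intr_int// !intrKfloor.
have := xy i; rewrite /merged_mesh eqxx (mulrC N%:R) !invfM !mulrA !floor_div//.
rewrite /q; move: (Num.floor _) (Num.floor _) => a b ab.
by rewrite {1}(divz_eq a N%:Z) {1}(divz_eq b N%:Z) ab; ring.
Qed.

(** At a point of column [c], the set [merged j] agrees with [U] translated by
    [j - c] cells. Passing from [A] to this translate costs a translation of [A] on
    column [c], and the error of [U] on column [j]. Summed over [j] and [c], the
    first costs amount to at most [2 * N] translations of [A], since fewer than
    [2 * N] values of [j - c] occur, and the second ones to [N] times the error of [U]. Some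
    [j] does at least as well as the mean. *)
Lemma merge_columns (r r' eta B : R) :
  0 < r' -> r' + N%:R * l i <= r ->
  (mu (inset Omega r' `&` (A `+` U)) <= eta%:E)%E ->
  (forall t, `|t| <= N%:R * l i ->
    (mu (inset Omega r `&` (A `+` axis_shift A i t)) <= B%:E)%E) ->
  exists U', gridset merged_mesh U' /\
    (mu (inset Omega r `&` (A `+` U')) <= (eta + 2 * B)%:E)%E.
Proof.
move=> r'0 rr etaP BP.
have li0 : 0 < l i by exact: l0.
have Nl0 : 0 < N%:R * l i by rewrite mulr_gt0// ltr0n.
have r0 : 0 < r by apply: lt_le_trans rr; rewrite addr_gt0.
have IO := inset_sub r0 : inset Omega r `<=` Omega.
have IO' := inset_sub r'0 : inset Omega r' `<=` Omega.
have fin X s : 0 < s -> mu (inset Omega s `&` X) = (fine (mu (inset Omega s `&` X)))%:E.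
  by move=> s0; apply: (lebesgue_fine bO) => x [/(inset_sub s0)].
pose col := column (l i) N i.
pose a (c : nat) (m : nat) : R :=
  fine (mu ((inset Omega r `&` (A `+` axis_shift A i ((m%:Z - (N.-1)%:Z)%:~R * l i))) `&` col c)).
pose b (c : nat) : R := fine (mu ((inset Omega r' `&` (A `+` U)) `&` col c)).
have a0 c m : 0 <= a c m by exact: fine_ge0.
have wP (j : 'I_N) : fine (mu (inset Omega r `&` (A `+` merged j))) <=
    \sum_(c < N) (a c (j + (N.-1 - c))%N + b j).
  rewrite -lee_fin -fin// -sumEFin.
  apply: (@le_trans _ _ (\sum_(c < N) mu ((inset Omega r `&` (A `+` merged j)) `&` col c))%E).
    have mc c : (@lebesgue_outer R n).-caratheodory (col c) by exact: measurable_column.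
    rewrite -(caratheodory_additive mc (@trivIset_column _ _ _) N); apply: le_outer_measure => x Ax; split => //.
    have [c _ xc] := qN x; rewrite -bigcup_mkord; exists c => //=.
  apply: lee_sum => c _; rewrite EFinD.
  pose t := (j%:Z - c%:Z)%:~R * l i.
  have tE : (((j + (N.-1 - c))%N)%:Z - (N.-1)%:Z)%:~R * l i = t.
    rewrite /t; congr (_%:~R * _); have := ltn_ord c; lia.
  have tN : `|t| <= N%:R * l i.
    rewrite /t normrM (gtr0_norm li0); apply: ler_wpM2r; first exact: ltW.
    rewrite -intr_norm.
    rewrite -[N%:R]/(N%:Z%:~R) ler_int; have := ltn_ord c; have := ltn_ord j; lia.
  have -> : (a c (j + (N.-1 - c))%N)%:E =
      mu (inset Omega r `&` ((A `+` axis_shift A i t) `&` col c)).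
    by rewrite /a tE -setIA -fin.
  have -> : (b j)%:E = mu (inset Omega r' `&` ((A `+` U) `&` col j)).
    by rewrite /b -setIA -fin.
  apply: (@le_trans _ _ (mu (inset Omega r `&` ((A `+` axis_shift A i t) `&` col c)) +
     mu (inset Omega r `&` ((axis_shift A i t `+` axis_shift U i t) `&` col c)))%E).
    apply: le_trans (lebesgueU_le _ _); apply: le_outer_measure => x [[Ox AU] xc].
    have qx : q x = c%:Z by exact: xc.
    have : (A `+` axis_shift U i t) x.
      by move: AU; rewrite !setY_def /merged /axis_shift /translate /= qx.
    by move=> /(setY_triangle (axis_shift A i t))[?|?]; [left|right].
  apply: leeD => //; rewrite -[leRHS](lebesgue_translate (t *: ebasis i)).
  apply: le_outer_measure => x [Ox [AU xc]]; split.
    by apply: inset_axis Ox => //; lra.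
  split => //; rewrite /col /column /= !mxE !eqxx /= mulr1 mulrDl mulfK ?gt_eqF//.
  rewrite floorDrz ?intr_int// intrKfloor -modzDml xc.
  rewrite addrC subrK modz_small//; by have := ltn_ord j; lia.
have [j wj] : exists j : 'I_N, fine (mu (inset Omega r `&` (A `+` merged j))) <= eta + 2 * B.
  apply: exists_le_average => //; apply: le_trans (ler_sum _ (fun j _ => wP j)) _.
  under eq_bigr do rewrite big_split /=.
  rewrite big_split /= mulrDr addrC; apply: lerD.
    under eq_bigr do rewrite sumr_const card_ord -mulr_natl.
    rewrite -mulr_sumr ler_wpM2l//; apply: (@le_trans _ _ (fine (mu (inset Omega r' `&` (A `+` U))))).
      by apply: sum_column => //; rewrite fin// ltry.
    by rewrite -lee_fin -fin.
  rewrite exchange_big /=.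
  apply: (@le_trans _ _ (\sum_(c < N) \sum_(m < N + N) a c m)).
    by apply: ler_sum => c _; apply: (sum_shifted_le (g := a c)).
  rewrite exchange_big /=.
  apply: (@le_trans _ _ (\sum_(m < N + N) B)); last first.
    by rewrite sumr_const card_ord mulrnDr -[B *+ N]mulr_natl; lra.
  apply: ler_sum => m _; set t := (m%:Z - (N.-1)%:Z)%:~R * l i.
  apply: (@le_trans _ _ (fine (mu (inset Omega r `&` (A `+` axis_shift A i t))))).
    by apply: sum_column => //; rewrite fin// ltry.
  rewrite -lee_fin -fin//; apply: BP.
  rewrite /t normrM (gtr0_norm li0); apply: ler_wpM2r; first exact: ltW.
    rewrite -intr_norm.
  rewrite -[N%:R]/(N%:Z%:~R) ler_int; have := ltn_ord m; lia.
exists (merged j); split; first exact: gridset_merged.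
by rewrite fin// lee_fin.
Qed.

End merge.

End grids.

(** * Approximation by unions of cells of a coarse grid *)

Section grid_approximation.
Context {R : realType} {n : nat}.
Local Notation Rd := 'rV[R]_n.+1.
Local Notation mu := (@lebesgue R n).
Implicit Types (x y v : Rd) (i : 'I_n.+1) (e r t s : R)
  (Omega X Y A B D U : set Rd) (l : 'I_n.+1 -> R).

Lemma same_cell_lt l x y j : 0 < l j -> same_cell l x y -> `|x ord0 j - y ord0 j| < l j.
Proof.
move=> l0 xy; have := xy j; have := floor_itv (x ord0 j / l j); have := floor_itv (y ord0 j / l j).
move=> + + E; rewrite E; move: (Num.floor _) => m; rewrite intrD.
rewrite !ler_pdivlMr// !ltr_pdivrMr// !mulrDl mul1r.
move=> /andP[? ?] /andP[? ?]; rewrite ltr_norml; apply/andP; split; lra.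
Qed.

(** Otherwise points of [K] would accumulate at the closed set [K']. *)
Lemma compact_separation (K K' : set Rd) (L : R) : 0 < L -> compact K -> closed K' ->
  K `&` K' = set0 ->
  exists N : nat, forall x y, K x -> K' y -> ~ ball x (L / N.+1%:R) y.
Proof.
move=> L0 /compact_near_coveringP cK clK' KK'.
have := cK nat \oo (fun N x => ball x (L / N.+1%:R) `<=` ~` K') _ _.
case.
  move=> x Kx; have : nbhs x (~` K').
    apply: open_nbhs_nbhs; split; first exact: closed_openC.
    by move=> K'x; have : (K `&` K') x by []; rewrite KK'.
  move=> /nbhs_ballP[e /= e0 eK'].
  have e2 : 0 < e / 2 / L by rewrite !divr_gt0.
  exists (ball x (e / 2), [set N | N.+1%:R^-1 < e / 2 / L]).
    split; first by apply: nbhsx_ballx; rewrite divr_gt0.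
    exact: (near_infty_natSinv_lt (PosNum e2)).
  move=> [z N] /= [xz Ne] y zy; apply: eK'.
  have Le : L / N.+1%:R < e / 2 by rewrite mulrC -ltr_pdivlMr.
  have := ball_triangle xz (le_ball (ltW Le) zy); by rewrite -splitr.
move=> N _ /(_ N (leqnn N)) H; exists N => x y Kx K'y xy; exact: (H x Kx y xy).
Qed.

(** Compact subsets nearly exhausting [D `&` A] and [D `\` A] are at a positive
    distance, so no cell of a fine grid meets both. *)
Lemma fine_gridset Omega A (r L eta : R) : bounded_set Omega -> measurable A ->
  0 < r -> 0 < L -> 0 < eta ->
  exists N U, [/\ (0 < N)%N, gridset (fun=> L / N%:R) U &
    (mu (inset Omega r `&` (A `+` U)) <= eta%:E)%E].
Proof.
move=> bO mA r0 L0 eta0; set D := inset Omega r.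
have mD : measurable D by apply: closed_measurable_Rd; exact: closed_inset.
have bD : bounded_set D by apply: bounded_subset bO; exact: inset_sub.
have eta2 : 0 < eta / 2 by rewrite divr_gt0.
have [K [clK KA DK]] := lebesgue_inner_regular eta2 (measurableI _ _ mD mA) (bounded_subset (@subIsetl _ _ _) bD).
have [K' [clK' KA' DK']] := lebesgue_inner_regular eta2 (measurableD mD mA) (bounded_subset (@subDsetl _ _ _) bD).
have cK : compact K.
  by apply: bounded_closed_compact => //; apply: bounded_subset bD => x /KA[].
have [|N HN] := compact_separation L0 cK clK'.
  by apply/seteqP; split=> x // [/KA[_ Ax] /KA'[_]].
pose l : 'I_n.+1 -> R := fun=> L / N.+1%:R.
have l0 j : 0 < l j by rewrite divr_gt0.
exists N.+1, [set x | exists2 z, K z & same_cell l z x]; split => //.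
  by move=> x y xy [z Kz zx]; exists z => // j; rewrite zx xy.
apply: (@le_trans _ _ (mu (D `&` A `\` K) + mu (D `\` A `\` K'))%E); last first.
  by rewrite (splitr eta) EFinD; exact: leeD.
apply: le_trans (lebesgueU_le _ _); apply: le_outer_measure => x [Dx].
rewrite setY_def => -[[Ax nU]|[[z Kz zx] nA]].
  by left; split => // Kx; apply: nU; exists x.
right; split => // K'x; apply: (HN z x Kz K'x); apply/ball_coordP; split; first exact: (l0 ord0).
by move=> j; exact: (same_cell_lt (l0 j) zx).
Qed.

(** A grid whose fineness depends on [A] in an uncontrolled way is coarsened to
    the mesh [L] by merging its cells in one direction after the other. The error
    of the merging does not depend on how fine the first grid was. *)
Lemma grid_approximation Omega A (C e L : R) : bounded_set Omega -> measurable A ->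
  0 <= C -> 0 < e -> 0 < L ->
  shift_bound Omega C e A ->
  exists U, gridset (fun=> L) U /\
    (mu (inset Omega (n.+2%:R * (2 * L)) `&` (A `+` U)) <=
     (L + n.+1%:R * (2 * (C * (L + e))))%:E)%E.
Proof.
move=> bO mA C0 e0 L0 sA.
have L2 : 0 < 1%:R * (2 * L) by rewrite mul1r mulr_gt0.
have [N [U0 [N0 gU0 AU0]]] := fine_gridset bO mA L2 L0 L0.
have Nn : N%:R != 0 :> R by rewrite pnatr_eq0 -lt0n.
(* The mesh after merging in the first k directions. *)
pose mesh k : 'I_n.+1 -> R := fun j => if (j < k)%N then L else L / N%:R.
have mesh0 k j : 0 < mesh k j by rewrite /mesh; case: ifP => // _; rewrite divr_gt0// ltr0n.
have key k : (k <= n.+1)%N -> exists U, gridset (mesh k) U /\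
    (mu (inset Omega (k.+1%:R * (2 * L)) `&` (A `+` U)) <=
     (L + k%:R * (2 * (C * (L + e))))%:E)%E.
  elim: k => [_|k IH kn]; first by exists U0; rewrite mul0r addr0.
  have [U [gU AU]] := IH (ltnW kn).
  pose i := Ordinal kn.
  have mi : N%:R * mesh k i = L by rewrite /mesh /= ltnn mulrC divfK.
  have meshE : merged_mesh (mesh k) i N = mesh k.+1.
    apply: funext => j; rewrite /merged_mesh; have [->|ji] := eqVneq j i.
      by rewrite mi /mesh /= ltnSn.
    rewrite /mesh ltnS [in RHS]leq_eqVlt (_ : (j == k :> nat) = false)//.
    by apply/negbTE; apply: contra ji => /eqP jk; apply/eqP/val_inj.
  have := merge_columns (r := k.+2%:R * (2 * L)) (B := C * (L + e)) bO N0 (mesh0 k) gU (i := i) _ _ AU _.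
  rewrite meshE; case.
  - by rewrite mulr_gt0// mulr_gt0.
  - by rewrite mi -[k.+2%:R]natr1 mulrDl mul1r; move: (k.+1%:R * (2 * L)) => z; lra.
  - move=> t tL; rewrite mi in tL; apply: (le_trans (sA i t _ _)).
      apply: (@le_lt_trans _ _ (1 * (2 * L))); first by rewrite mul1r; lra.
      by rewrite ltr_pM2r ?mulr_gt0// ltr1n.
    by rewrite lee_fin ler_wpM2l// lerD2r.
  move=> U' [gU' AU']; exists U'; split => //; apply: le_trans AU' _.
  by rewrite lee_fin -[k.+1%:R]natr1; move: (2 * (C * _)) => z; rewrite mulrDl mul1r addrA.
have [U [gU AU]] := key n.+1 (leqnn _).
exists U; split => //; congr gridset : gU.
by apply: funext => j; rewrite /mesh ltn_ord.
Qed.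

Lemma finite_cells Omega (L : R) : 0 < L -> bounded_set Omega ->
  exists (T : finType) (idx : Rd -> T), forall x y, Omega x -> Omega y ->
    idx x = idx y -> same_cell (fun=> L) x y.
Proof.
move=> L0 [M0 [Mr HM]]; pose M := `|M0| + 1.
have xM x j : Omega x -> `|x ord0 j| <= M.
  move=> Ox; have Mx : `|x| <= M.
    by apply: (HM M) => //; rewrite (le_lt_trans (ler_norm _))// ltrDl.
  apply: le_trans Mx; rewrite [leRHS]/Num.norm /= mx_normrE.
  by apply/bigmax_geP; right => /=; exists (ord0, j).
pose K := Num.truncn (M / L + 1).
pose f (x : Rd) (j : 'I_n.+1) := Num.floor (x ord0 j / L).
have fK x j : Omega x -> (`|f x j| <= K)%N.
  move=> /(xM _ j); rewrite ler_norml => /andP[x1 x2].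
  have ML0 : 0 <= M / L + 1 by rewrite addr_ge0// divr_ge0 ?addr_ge0// ltW.
  have /andP[_ K2] : K%:R <= M / L + 1 < K.+1%:R by exact: truncn_itv.
  have KM : M / L <= K%:R by rewrite -natr1 ltrD2r in K2; exact: ltW.
  have h1 : - K%:Z <= f x j.
    rewrite floor_ge_int mulrNz; apply: (@le_trans _ _ (- M / L)); first by rewrite mulNr lerN2.
    by rewrite ler_pM2r// invr_gt0.
  have h2 : f x j < K%:Z + 1.
    rewrite floor_lt_int; apply: (@le_lt_trans _ _ (M / L)); first by rewrite ler_pM2r// invr_gt0.
    by rewrite intrD; apply: (le_lt_trans KM); rewrite ltrDl.
  lia.
exists {ffun 'I_n.+1 -> 'I_(K + K).+1}, (fun x => [ffun j : 'I_n.+1 => (inord `|(f x j + K%:Z)%R|%N : 'I_(K + K).+1)]).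
move=> x y Ox Oy /ffunP xy j; have := xy j; rewrite !ffunE => /(congr1 val) /=.
have := fK x j Ox; have := fK y j Oy; rewrite -/(f x j) -/(f y j) => fy fx.
rewrite !inordK; lia.
Qed.

(** Only finitely many cells meet [Omega], so up to what happens outside [Omega],
    the [U k] take finitely many values, one of which the ultrafilter selects. *)
Lemma ultralimit_gridsets Omega (L : R) (G : set_system nat) (U : nat -> set Rd) :
  0 < L -> bounded_set Omega -> UltraFilter G -> (forall k, gridset (fun=> L) (U k)) ->
  exists B, G [set k | forall x, Omega x -> (U k x <-> B x)].
Proof.
move=> L0 bO UG gU; have [T [idx idxP]] := finite_cells L0 bO.
pose y k (c : T) := exists2 x, Omega x /\ U k x & idx x = c.
pose yG c := G [set k | y k c].
exists [set x | yG (idx x)].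
have FG : Filter G by apply: filter_filter.
have H : \forall k \near G, forall c, y k c <-> yG c.
  apply: filter_forall => c; have [yc|yc] := pselect (yG c).
    by apply: (@filterS _ G FG [set k | y k c]) => // k ykc; split.
  have := in_ultra_setVsetC [set k | y k c] UG => -[//|nyc].
  by apply: (@filterS _ G FG (~` [set k | y k c])) => // k nyk; split.
apply: filterS H => k H x Ox; split=> [Ux|/H[z [Oz Uz] zx]].
  by apply/H; exists x.
by apply: gU Uz; exact: idxP.
Qed.

End grid_approximation.

(** * Convergent subsequences *)

Section compactness.
Context {R : realType} {n : nat}.
Local Notation Rd := 'rV[R]_n.+1.
Local Notation mu := (@lebesgue R n).
Implicit Types (x y v : Rd) (i : 'I_n.+1) (r t s : R)
  (Omega X Y B D : set Rd) (l : 'I_n.+1 -> R).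

(** The sets removed decrease to the empty set because [Omega] is open. *)
Lemma inset_exhausts Omega (kappa eta : R) : open Omega -> bounded_set Omega ->
  0 < kappa -> 0 < eta ->
  exists L, [/\ 0 < L, L <= eta & (mu (Omega `\` inset Omega (kappa * L)) <= eta%:E)%E].
Proof.
move=> oO bO k0 eta0; have mO := open_measurable_Rd oO.
pose r j : R := kappa * j.+1%:R^-1.
have r0 j : 0 < r j by rewrite mulr_gt0// invr_gt0.
pose F j := Omega `\` inset Omega (r j).
have mF j : measurable (F j).
  by apply: measurableD => //; apply: closed_measurable_Rd; exact: closed_inset.
have F0 : \bigcap_j F j = set0.
  apply/seteqP; split=> x // Fx; have [Ox _] := Fx 0%N I.
  have /nbhs_ballP[e /= e0 eO] : nbhs x Omega by exact: open_nbhs_nbhs.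
  have ek : 0 < e / kappa by rewrite divr_gt0.
  have [j _ /(_ j (leqnn j)) /= Hj] := near_infty_natSinv_lt (PosNum ek).
  have [_ nx] := Fx j I; apply: nx => y /ball_coordP[_ xy]; apply: eO.
  apply/ball_coordP; split => // k; apply: lt_trans (xy k) _.
  by rewrite /r mulrC -ltr_pdivlMr.
have Foo : (mu (F 0%N) < +oo)%E.
  by apply: bounded_lebesgue_lty; apply: bounded_subset bO; exact: subDsetl.
have hF : {homo F : a b / (a <= b)%N >-> (b <= a)%O}.
  move=> a b ab; apply/subsetPset => x [Ox nx]; split => // xa; apply: nx.
  apply: le_inset xa; rewrite r0 /=; rewrite /r ler_pM2l// lef_pV2 ?posrE// ler_nat.
  exact: ab.
have := @nonincreasing_cvg_mu _ _ _ mu F Foo mF; rewrite F0 => /(_ measurable0 hF).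
rewrite measure0.
move=> Fcvg.
have : \forall j \near \oo, (mu (F j) < eta%:E)%E /\ j.+1%:R^-1 < eta.
  near=> j; split; near: j; last exact: (near_infty_natSinv_lt (PosNum eta0)).
  apply: (Fcvg [set z : \bar R | (z < eta%:E)%E]).
  by apply: open_nbhs_nbhs; split; [exact: open_ereal_lt_ereal|rewrite /= lte_fin].
move=> [j _ /(_ j (leqnn j)) [Fj jeta]]; exists j.+1%:R^-1.
by split; [rewrite invr_gt0|exact: ltW|exact: ltW].
Unshelve. all: by end_near. Qed.

Lemma filter_forall_le (G : set_system nat) (P : nat -> nat -> Prop) (p : nat) : Filter G ->
  (forall q, G [set k | P q k]) -> G [set k | forall q, (q <= p)%N -> P q k].
Proof.
move=> FG GP; elim: p => [|p IH].
  by apply: filterS (GP 0%N) => k Pk q; rewrite leqn0 => /eqP ->.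
apply: filterS2 IH (GP p.+1) => k H1 H2 q; rewrite leq_eqVlt => /orP[/eqP -> //|].
by rewrite ltnS; exact: H1.
Qed.

(** A point at which [E p] differs from the upper limit changes membership between
    two consecutive sets after [p], and these differences have summable measure. *)
Lemma cauchy_sets (E : nat -> set Rd) :
  (forall p, (mu (E p `+` E p.+1) <= (2^-1 ^+ p)%:E)%E) ->
  forall p, (mu (E p `+` \bigcap_q \bigcup_(k in [set k | (q <= k)%N]) E k) <=
    (2 * 2^-1 ^+ p)%:E)%E.
Proof.
move=> EC p; set B := \bigcap_q _.
pose J q := E (p + q)%N `+` E (p + q).+1.
apply: (@le_trans _ _ (mu (\bigcup_q J q))).
  apply: le_outer_measure => x; rewrite setY_def => H; apply: contrapT => nJ.
  have const q : E p x <-> E (p + q)%N x.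
    elim: q => [|q IH]; first by rewrite addn0.
    have [Eq|Eq] := pselect (E (p + q)%N x).
      split=> [_|_]; last exact/IH.
      rewrite addnS; apply: contrapT => nE; apply: nJ; exists q => //.
      by rewrite /J setY_def; left.
    split=> [/IH//|]; rewrite addnS => Eq1; exfalso; apply: nJ; exists q => //.
    by rewrite /J setY_def; right.
  case: H => -[].
    move=> Ex; apply => q _; exists (p + q)%N; first exact: leq_addl.
    exact/const.
  move=> Bx; apply; have [k pk Ek] := Bx p I.
  by apply/(const (k - p)%N); rewrite subnKC.
apply: (le_trans (outer_measure_sigma_subadditive _ _)).
apply: le_trans (epsilon_trick0 xpredT _); last by rewrite mulr_ge0// exprn_ge0// invr_ge0.
apply: lee_nneseries => // q _; apply: le_trans (EC _) _.
rewrite lee_fin exprD natrX exprS invfM [X in _ <= X](_ : _ = 2^-1 ^+ p * 2^-1 ^+ q) //.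
by rewrite -[(2 ^+ q)^-1]exprVn; move: (2^-1 ^+ p) (2^-1 ^+ q) => a b; field.
Qed.

(** For each scale [L p], the ultrafilter makes the grid approximations of all the
    [A k] with [k] in one of its members agree inside [Omega]. Choosing
    [s p] among the indices that are good for all the scales up to [p] makes [A (s p)] and [A (s p.+1)] share
    their approximation at scale [L p], hence close to each other. *)
Lemma set_compactness Omega (A : nat -> set Rd) (e : nat -> R) (C : R) :
  open Omega -> bounded_set Omega -> (forall k, measurable (A k)) ->
  (forall k, A k `<=` Omega) -> 0 <= C -> (forall k, 0 < e k) -> e @ \oo --> (0 : R) ->
  (\forall k \near \oo, shift_bound Omega C (e k) (A k)) ->
  exists (s : nat -> nat) (B : set Rd), [/\ increasing_seq s, measurable B, B `<=` Omega &
    forall p, (mu (A (s p) `+` B) <= (2 * 2^-1 ^+ p)%:E)%E].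
Proof.
move=> oO bO mA AO C0 e0 ecvg sA.
(* With kappa the width required by grid_approximation, Q * L bounds its error
   when e <= L. Two such errors at scale L p and the loss near the boundary of
   Omega amount to at most (2 * Q + 1) * eta p = 2^-1 ^+ p. *)
pose kappa : R := n.+2%:R * 2; have kappa0 : 0 < kappa by rewrite mulr_gt0.
pose Q : R := 1 + n.+1%:R * (4 * C).
have Q0 : 0 < Q by rewrite ltr_pwDl// !mulr_ge0.
pose eta p : R := 2^-1 ^+ p / (2 * Q + 1).
have eta0 p : 0 < eta p by rewrite divr_gt0 ?exprn_gt0 ?invr_gt0// addr_gt0// mulr_gt0.
have /choice[L LP] : forall p, exists L, [/\ 0 < L, L <= eta p &
    (mu (Omega `\` inset Omega (kappa * L)) <= (eta p)%:E)%E].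
  by move=> p; exact: inset_exhausts.
have L0 p : 0 < L p by have [] := LP p.
have /choice[U UP] : forall pk : nat * nat, exists U, gridset (fun=> L pk.1) U /\
    (shift_bound Omega C (e pk.2) (A pk.2) -> e pk.2 <= L pk.1 ->
      (mu (inset Omega (kappa * L pk.1) `&` (A pk.2 `+` U)) <= (Q * L pk.1)%:E)%E).
  move=> [p k] /=; have [[sk ek]|nk] := pselect (shift_bound Omega C (e k) (A k) /\ e k <= L p); last first.
    by exists set0; split=> // sk ek; exfalso; apply: nk.
  have [U [gU AU]] := grid_approximation bO (mA k) C0 (e0 k) (L0 p) sk.
  exists U; split=> // _ _; rewrite /kappa -mulrA; apply: le_trans AU _.
  rewrite lee_fin /Q [(1 + _) * _]mulrDl mul1r lerD2l -mulrA ler_wpM2l//.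
  rewrite -mulrA (_ : 4 * (C * L p) = 2 * (C * (L p + L p))); last by ring.
  by rewrite !ler_wpM2l// lerD2l.
have [G [UG GF]] := ultraFilterLemma (F := \oo : set_system nat) _.
have FG : Filter G by exact: filter_filter.
have PG : ProperFilter G by exact: ultra_proper.
have /choice[W WP] : forall p, exists W, G [set k | forall x, Omega x -> (U (p, k) x <-> W x)].
  by move=> p; apply: (ultralimit_gridsets (L0 p) bO UG) => k; have [] := UP (p, k).
pose good p k := [/\ shift_bound Omega C (e k) (A k), e k <= L p &
  forall x, Omega x -> (U (p, k) x <-> W p x)].
have Ggood p : G [set k | good p k].
  have h1 : G [set k | shift_bound Omega C (e k) (A k)] by exact: GF.
  have h2 : G [set k | e k <= L p].
    apply: GF; have : \forall k \near \oo, e k < L p by apply: (cvgr_lt 0 ecvg).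
    by apply: filterS => k /ltW.
  by apply: filterS3 h1 h2 (WP p).
have next p m : exists k, (m < k)%N /\ forall q, (q <= p)%N -> good q k.
  have h1 : G [set k | (m < k)%N] by apply: GF; exact: nbhs_infty_gt.
  have h2 := filter_forall_le p FG Ggood.
  by have [k [? ?]] := filter_ex (filterI h1 h2); exists k.
have /choice[f fP] : forall pm : nat * nat, exists k, (pm.2 < k)%N /\
    forall q, (q <= pm.1)%N -> good q k by move=> [p m]; exact: next.
pose s := fix s p := if p is p'.+1 then f (p, s p') else f (0%N, 0%N).
have sinc p : (s p < s p.+1)%N by have [] := fP (p.+1, s p).
have sgood p q : (q <= p)%N -> good q (s p).
  by case: p => [|p]; [have [_] := fP (0%N, 0%N)|have [_] := fP (p.+1, s p)]; exact.
pose E p := A (s p).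
have EC p : (mu (E p `+` E p.+1) <= (2^-1 ^+ p)%:E)%E.
  have [s1 e1 W1] := sgood p p (leqnn p); have [s2 e2 W2] := sgood p.+1 p (leqnSn p).
  have [_ U1] := UP (p, s p); have [_ U2] := UP (p, s p.+1).
  have [_ Le LO] := LP p.
  set I := inset Omega (kappa * L p) in U1 U2 LO.
  apply: (@le_trans _ _ (mu (Omega `\` I) + (mu (I `&` (E p `+` U (p, s p))) +
     mu (I `&` (E p.+1 `+` U (p, s p.+1)))))%E).
    apply: (@le_trans _ _ (mu (Omega `\` I) + (mu ((I `&` (E p `+` U (p, s p))) `|`
     (I `&` (E p.+1 `+` U (p, s p.+1))))))%E); last by apply: leeD => //; exact: lebesgueU_le.
    apply: le_trans (lebesgueU_le _ _); apply: le_outer_measure => x EE.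
    have Ox : Omega x by move: EE; rewrite setY_def => -[[/AO]|[/AO]].
    have [Ix|Ix] := pselect (I x); last by left.
    right; have /(_ x)[|h|h] := @setY_triangle _ _ (E p) (U (p, s p)) (E p.+1); [exact: EE|by left|right].
    split => //; move: h; rewrite setYC !setY_def.
    by move: (W1 x Ox) (W2 x Ox); rewrite /=; tauto.
  apply: (@le_trans _ _ ((eta p)%:E + ((Q * L p)%:E + (Q * L p)%:E))%E).
    by apply: leeD => //; apply: leeD; [exact: U1|exact: U2].
  rewrite -!EFinD lee_fin; apply: (@le_trans _ _ ((2 * Q + 1) * eta p)); last first.
    by rewrite /eta mulrC divfK// gt_eqF// addr_gt0// mulr_gt0.
  have : Q * L p <= Q * eta p by rewrite ler_pM2l.
  by lra.
exists s, (\bigcap_q \bigcup_(k in [set k | (q <= k)%N]) E k); split.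
- by apply/increasing_seqP.
- by apply: bigcapT_measurable => q; apply: bigcup_measurable => k _; exact: mA.
- by move=> x /(_ 0%N I)[k _ /AO].
- exact: cauchy_sets EC.
Qed.

Lemma shift_bound_limit Omega (C : R) (A : nat -> set Rd) (e : nat -> R) B :
  0 <= C -> e @ \oo --> (0 : R) ->
  (\forall p \near \oo, shift_bound Omega C (e p) (A p)) ->
  (forall p, (mu (A p `+` B) <= (2 * 2^-1 ^+ p)%:E)%E) ->
  shift_bound Omega C 0 B.
Proof.
move=> C0 ecvg sA AB i t r tr; apply/lee_addgt0Pr => eta eta0.
have C1 : 0 < C + 1 by rewrite ltr_wpDl.
have [p [sp ep pp]] : exists p, [/\ shift_bound Omega C (e p) (A p),
    e p < eta / 2 / (C + 1) & 2^-1 ^+ p < eta / 8].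
  have h1 : \forall p \near \oo, e p < eta / 2 / (C + 1).
    by apply: (cvgr_lt 0 ecvg); rewrite !divr_gt0.
  have h2 : \forall p \near \oo, (2^-1 : R) ^+ p < eta / 8.
    have c2 : (GRing.exp (2^-1 : R)) @ \oo --> (0 : R) by apply: cvg_expr; rewrite ger0_norm; lra.
    by apply: (cvgr_lt 0 c2); rewrite divr_gt0.
  by have [p [? [? ?]]] := filter_ex (filterI sA (filterI h1 h2)); exists p.
apply: (@le_trans _ _ (mu (A p `+` B) + (mu (inset Omega r `&` (A p `+` axis_shift (A p) i t)) +
   mu (axis_shift (A p `+` B) i t)))%E).
  apply: (@le_trans _ _ (mu (A p `+` B) + (mu ((inset Omega r `&` (A p `+` axis_shift (A p) i t)) `|`
     axis_shift (A p `+` B) i t)))%E); last by apply: leeD => //; exact: lebesgueU_le.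
  apply: le_trans (lebesgueU_le _ _); apply: le_outer_measure => x [Ox].
  move=> /(@setY_triangle _ _ _ (A p) _ x)[h|h]; first by left; rewrite setYC.
  right; have [h'|h'] := @setY_triangle _ _ (A p) (axis_shift (A p) i t) (axis_shift B i t) x h.
    by left.
  by right.
rewrite /axis_shift lebesgue_translate.
apply: (@le_trans _ _ ((2 * 2^-1 ^+ p)%:E + ((C * (`|t| + e p))%:E + (2 * 2^-1 ^+ p)%:E))%E).
  by apply: leeD; [exact: AB|apply: leeD; [exact: sp|exact: AB]].
rewrite -!EFinD lee_fin addr0 mulrDr.
have : C * e p <= eta / 2.
  apply: (@le_trans _ _ (C * (eta / 2 / (C + 1)))); first by rewrite ler_wpM2l// ltW.
  rewrite mulrA ler_pdivrMr// mulrC ler_pM2l ?divr_gt0//; lra.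
move: pp; move: (2^-1 ^+ p) (C * e p) (C * `|t|) => a b c ? ?; lra.
Qed.

End compactness.

(** * Linear translation bounds imply finite perimeter *)

Section finite_perimeter_of_the_limit.
Context {R : realType} {n : nat}.
Local Notation Rd := 'rV[R]_n.+1.
Local Notation mu := (@lebesgue R n).
Implicit Types (x y v : Rd) (i : 'I_n.+1) (r t s : R)
  (Omega X Y B D K : set Rd) (psi : Rd -> R).

Lemma derive_bound (F : R -> R) (d C : R) : is_derive (0 : R) (1 : R) F d ->
  (\forall h \near (0 : R), `|F h - F 0| <= C * `|h|) -> `|d| <= C.
Proof.
move=> [dF <-] FC.
have := dF; rewrite /derivable => /cvg_ex[l Fl].
rewrite (_ : 'D_1 F 0 = l); last by exact: (cvg_lim _ Fl).
apply: (@closed_cvg _ _ (0 : R)^' _ (fun h => `|h^-1 *: ((F \o shift 0) (h *: (1 : R)) - F 0)|)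
   [set z : R | z <= C] (@closed_le R C)); last exact: cvg_norm.
near=> h; have h0 : h != 0 by near: h; exact: nbhs_dnbhs_neq.
rewrite /shift /= -[h *: 1]/(h * 1) mulr1 addr0 normrZ normfV.
rewrite mulrC ler_pdivrMr ?normr_gt0//.
by near: h; exact: nbhs_dnbhs.
Unshelve. all: by end_near. Qed.

Lemma compact_inset_sub Omega K : open Omega -> compact K -> K `<=` Omega ->
  exists r, 0 < r /\ K `<=` inset Omega r.
Proof.
move=> oO cK KO.
have [|N HN] := @compact_separation R n K (~` Omega) 1 ltr01 cK (open_closedC oO).
  by apply/seteqP; split=> x // [/KO].
exists (1 / N.+1%:R); split; first by rewrite divr_gt0.
move=> x Kx y xy; apply: contrapT => Oy; exact: (HN x y Kx Oy xy).
Qed.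

(** The integral is the derivative at [h = 0] of the integral of [psi] over a
    translate of [B] by [h]. As [psi] is bounded by [1] and supported in an
    [inset], the increments of this function are bounded by the measure of the difference
    between [B] and its translate. *)
Lemma shift_bound_derive Omega B (C : R) psi i : open Omega -> bounded_set Omega ->
  measurable B -> B `<=` Omega -> 0 <= C -> shift_bound Omega C 0 B ->
  C1c psi -> ssupp psi `<=` Omega -> (forall x, `|psi x| <= 1) ->
  `|\int[mu]_(x in Omega) (\1_B x * 'D_(ebasis i) psi x)| <= C.
Proof.
move=> oO bO mB BO C0 sB Cpsi sO psi1; have mO := open_measurable_Rd oO.
have [_ _ cs] := Cpsi.
have [r [r0 Kr]] := compact_inset_sub oO cs sO.
have Ooo := bounded_lebesgue_lty bO.
have iB : mu.-integrable Omega (EFin \o \1_B).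
  apply: measurable_bounded_integrable => //; exists 1; split; first exact: num_real.
  by move=> y /ltW y1 x _; apply: le_trans (indic_le1 _ _) y1.
have mpsi : measurable_fun setT psi by apply: continuous_measurable_Rd; exact: C1c_continuous.
have dF := is_derive_integral_shift i 0 mO iB Cpsi.
rewrite (_ : \int[mu]_(x in Omega) _ =
    \int[mu]_(x in Omega) (\1_B x * 'D_(ebasis i) psi (x + 0 *: ebasis i))); last first.
  by apply: eq_Rintegral => x _; rewrite scale0r addr0.
apply: (derive_bound dF); near=> h.
have h2 : 2 * `|- h| < r.
  have : `|h| < r / 2.
    by near: h; apply: (@nbhs0_lt R R); rewrite divr_gt0.
  by rewrite normrN; lra.
pose B' := axis_shift B i (- h).
have mB' : measurable B' by exact: measurable_translate.
have bB : bounded_set B := bounded_subset BO bO.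
have ipsi (Z : set Rd) : measurable Z -> (mu Z < +oo)%E -> mu.-integrable Z (EFin \o psi).
  move=> mZ Zoo; apply: measurable_bounded_integrable => //.
    exact: measurable_funTS.
  exists 1; split; first exact: num_real.
  by move=> y /ltW y1 x _; apply: le_trans (psi1 x) y1.
have Boo : (mu B < +oo)%E := bounded_lebesgue_lty bB.
have FE (s : R) : \int[mu]_(x in Omega) (\1_B x * psi (x + s *: ebasis i)) =
    \int[mu]_(x in axis_shift B i (- s)) psi x.
  have mBs : measurable (axis_shift B i (- s)) by exact: measurable_translate.
  have Bs : translate (s *: ebasis i) (axis_shift B i (- s)) = B.
    by rewrite /axis_shift scaleNr -[in RHS](translateK (- (s *: ebasis i)) B) opprK.
  have mEpsi : measurable_fun setT (EFin \o psi) by exact/measurable_EFinP.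
  have := integral_translate (s *: ebasis i) mBs mEpsi.
  rewrite Bs => /(_ (ipsi _ mBs _)); rewrite lebesgue_translate => /(_ Boo) /(congr1 fine).
  move=> psiE; apply: etrans psiE.
  transitivity (\int[mu]_(x in B) psi (x + s *: ebasis i)) => //.
  rewrite (Rintegral_indic (fun x => psi (x + s *: ebasis i)) BO).
  by apply: eq_Rintegral => x _; rewrite mulrC.
have B'oo : (mu B' < +oo)%E by rewrite lebesgue_translate.
have Woo : (mu (B `|` B') < +oo)%E.
  by apply: le_lt_trans (lebesgueU_le _ _) _; rewrite lte_add_pinfty.
have mW : measurable (B `|` B') by exact: measurableU.
rewrite !FE oppr0 -/B' (_ : axis_shift B i 0 = B); last first.
  by apply/seteqP; split=> x; rewrite /axis_shift /translate /= scale0r addr0.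
apply: le_trans (Rintegral_setY mW mB' mB (@subsetUr _ _ _) (@subsetUl _ _ _) (ipsi _ mW Woo)) _.
have mZ : measurable (B' `+` B) by exact: measurable_setY.
have := sB i (- h) r h2; rewrite setYC addr0 normrN -/B'.
move=> mule; rewrite /Rintegral.
suff le1 : (\int[mu]_(x in B' `+` B) `|psi x|%:E <= (C * `|h|)%:E)%E.
  rewrite -lee_fin fineK// ge0_fin_numE; first by apply: le_lt_trans le1 (ltry _).
  by apply: integral_ge0.
apply: le_trans mule; apply: (@le_trans _ _ (\int[mu]_(x in B' `+` B) (\1_(inset Omega r) x : R)%:E)%E).
  apply: ge0_le_integral.
  - exact: mZ.
  - by move=> x _; rewrite lee_fin.
  - by apply/measurable_EFinP/measurableT_comp => //; exact: measurable_funTS.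
  - apply/measurable_EFinP; apply: measurable_indic; apply: closed_measurable_Rd; exact: closed_inset.
  - move=> x _; rewrite lee_fin; have [px|px] := eqVneq (psi x) 0; first by rewrite px normr0.
    rewrite indicE mem_set//; apply: Kr; exact: subset_closure.
rewrite integral_indic//; apply: closed_measurable_Rd; exact: closed_inset.
Unshelve. all: by end_near. Qed.

(** The coordinates of a test field are test functions bounded by [1], and the
    divergence has [n.+1] terms. *)
Lemma shift_bound_finite_perimeter Omega B (C : R) : open Omega -> bounded_set Omega ->
  measurable B -> B `<=` Omega -> 0 <= C -> shift_bound Omega C 0 B ->
  finite_perimeter Omega B.
Proof.
move=> oO bO mB BO C0 sB; have mO := open_measurable_Rd oO.
have Ooo := bounded_lebesgue_lty bO.
have iB : mu.-integrable Omega (EFin \o \1_B).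
  apply: measurable_bounded_integrable => //; exists 1; split; first exact: num_real.
  by move=> y /ltW y1 x _; apply: le_trans (indic_le1 _ _) y1.
split=> //; apply: (@le_lt_trans _ _ (n.+1%:R * C)%:E); last exact: ltry.
apply: ge_ereal_sup => _ [phi [dphi cphi sphi phi1] <-].
pose psi i x := phi x ord0 i.
have dpsi i x v : derivable phi x v -> derivable (psi i) x v.
  by move=> /derivable_mxP/(_ ord0 i).
have dE i x v : derivable phi x v -> 'D_v (psi i) x = ('D_v phi x : Rd) ord0 i.
  by move=> dp; rewrite derive_mx// mxE.
have ssub i : ssupp (psi i) `<=` supp phi.
  apply: ssupp_sub_closed; first exact: closed_closure.
  move=> x px; apply: subset_closure; apply: contra px => /eqP px; apply/eqP.
  by rewrite /psi px mxE.
have Cpsi i : C1c (psi i).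
  split; last by apply: subclosed_compact cphi (ssub i); exact: closed_closure.
  - by move=> j x; apply: dpsi; have [d _] := dphi j; exact: d.
  - move=> j; have [d c] := dphi j.
    rewrite (_ : 'D__ _ = fun x => ('D_(ebasis j) phi x : Rd) ord0 i); last first.
      by apply: funext => x; exact: dE.
    move=> x; apply: (@continuous_comp _ _ _ ('D_(ebasis j) phi) (fun M : Rd => M ord0 i)).
      exact: c.
    exact: coord_continuous.
have psi1 i x : `|psi i x| <= 1 by apply: le_trans (coord_le_enorm _ _) (phi1 x).
have bnd i := shift_bound_derive i oO bO mB BO C0 sB (Cpsi i) (subset_trans (ssub i) sphi) (psi1 i).
have int i : mu.-integrable Omega (EFin \o (fun x => \1_B x * 'D_(ebasis i) (psi i) x)).
  have [M [M0 HM]] := C1c_derive_bounded i (Cpsi i).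
  have mD : measurable_fun setT ('D_(ebasis i) (psi i)).
    by apply: continuous_measurable_Rd; have [_ c _] := Cpsi i; exact: c.
  exact: (integrable_mul_bounded mO iB mD (ex_intro _ M HM)).
have -> : (\int[mu]_(x in Omega) (\1_B x * divergence phi x)%:E =
    \sum_i \int[mu]_(x in Omega) (\1_B x * 'D_(ebasis i) (psi i) x)%:E)%E.
  rewrite -integral_sum//; apply: eq_integral => x _; rewrite sumEFin -mulr_sumr.
  congr (_ * _)%:E; apply: eq_bigr => i _; rewrite dE//.
  by have [d _] := dphi i; exact: d.
have -> : (n.+1%:R * C)%:E = (\sum_(i < n.+1) C%:E)%E.
  by rewrite sumEFin sumr_const card_ord mulr_natl.
apply: lee_sum => i _; have := bnd i; rewrite /Rintegral.
rewrite -[X in (X <= _)%E]fineK; last by apply: integrable_fin_num => //; exact: int.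
by rewrite lee_fin; apply: le_trans; exact: ler_norm.
Qed.

End finite_perimeter_of_the_limit.

(** * Unpacking the hypotheses of the compactness theorem *)

Section reduction.
Context {R : realType} {n : nat}.
Local Notation Rd := 'rV[R]_n.+1.
Local Notation mu := (@lebesgue R n).

Lemma ereal_lty_bound (a : \bar R) : (a < +oo)%E -> exists M : R, 0 <= M /\ (a <= M%:E)%E.
Proof.
case: a => [a _| |_]; last by exists 0; split=> //; rewrite leNye.
  by exists `|a|; split=> //; rewrite lee_fin ler_norm.
by [].
Qed.

Lemma limn_esup_lty_bound (u : nat -> \bar R) : (limn_esup u < +oo)%E ->
  exists M : R, 0 <= M /\ \forall k \near \oo, (u k <= M%:E)%E.
Proof.
move=> /ereal_inf_lt[_ [D Doo <-]] /ereal_lty_bound[M [M0 supM]]; exists M; split=> //.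
apply: filterS Doo => k Dk; apply: le_trans supM; apply: ereal_sup_ubound; exists k => //.
Qed.

Lemma ess_inf_on_gt0_bound (Omega : set Rd) (f : Rd -> R) :
  (0 < ess_inf_on Omega (fun x => (f x)%:E))%E ->
  exists c, 0 < c /\ \forall x \ae mu, Omega x -> c <= f x.
Proof.
move=> /ereal_sup_gt[[c| |] /= ae_c c0].
- by exists c; split=> //; apply: filterS ae_c => x cf /cf; rewrite lee_fin.
(* An infinite lower bound forces Omega to be null. *)
- by exists 1; split=> //; apply: filterS ae_c => x cf /cf; rewrite leye_eq.
- by [].
Qed.

Lemma increasing_seq_cvg (s : nat -> nat) : increasing_seq s -> s @ \oo --> \oo.
Proof.
move=> sinc; have s_ge k : (k <= s k)%N.
  elim: k => // k ih; apply: leq_ltn_trans ih _.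
  have := sinc k.+1 k; rewrite ltnn => /negbT.
  by rewrite leEnat -ltnNge.
by move=> D [N _ ND]; exists N => // k /= Nk; apply: ND; exact: leq_trans Nk (s_ge k).
Qed.

Lemma integral_dist_indic (Omega X Y : set Rd) : measurable Omega -> measurable X -> measurable Y ->
  X `<=` Omega -> Y `<=` Omega ->
  (\int[mu]_(x in Omega) `|\1_X x - \1_Y x : R|%:E = mu (X `+` Y))%E.
Proof.
move=> mO mX mY XO YO.
rewrite -[in RHS](setIidl (_ : X `+` Y `<=` Omega)); last by move=> x; rewrite setY_def => -[[/XO]|[/YO]].
rewrite -integral_indic//; last exact: measurable_setY.
apply: eq_integral => x _; congr (_%:E); rewrite !indicE.
rewrite (_ : (x \in X `+` Y) = (x \in X) (+) (x \in Y)).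
  by case: (x \in X); case: (x \in Y); rewrite /= ?subrr ?subr0 ?sub0r ?normrN ?normr0 ?normr1.
rewrite setYE !(in_setD, in_setU, in_setI).
by case: (x \in X); case: (x \in Y).
Qed.

End reduction.

Theorem theorem2p1 (R : realType) (n : nat) (Omega : set 'rV[R]_n.+1)
    (Omega_open : open Omega) (Omega_bounded : bounded_set Omega)
    (Omega_lipschitz : lipschitz_domain Omega)
    (rho0 rho1 : 'rV[R]_n.+1 -> R)
    (rho0_BV : BV Omega rho0) (rho0_Linfty : Linfty Omega rho0)
    (rho1_BV : BV Omega rho1) (rho1_Linfty : Linfty Omega rho1)
    (rho0_ge0 : \forall x \ae lebesgue, Omega x -> 0 <= rho0 x)
    (rho1_ge0 : \forall x \ae lebesgue, Omega x -> 0 <= rho1 x)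
    (rho_gt0 : (0 < ess_inf_on Omega (fun x => (rho0 x + rho1 x)%:E))%E)
    (eps : nat -> R) (eps_gt0 : forall k, 0 < eps k)
    (eps_cvg0 : eps @ \oo --> (0 : R))
    (A : nat -> set 'rV[R]_n.+1)
    (A_measurable : forall k, measurable (A k))
    (A_sub : forall k, A k `<=` Omega)
    (Per_bounded :
      (limn_esup (fun k => Per Omega rho0 rho1 (eps k) (A k)) < +oo)%E) :
  exists (s : nat -> nat) (B : set 'rV[R]_n.+1),
    [/\ increasing_seq s, B `<=` Omega,
        (fun k => \int[lebesgue]_(x in Omega)
           `|\1_(A (s k)) x - \1_B x : R|%:E)%E @ \oo --> (0 : \bar R)%E &
        finite_perimeter Omega B].
Proof.
have [i0 /ereal_lty_bound[V0 [V00 v0]]] := rho0_BV.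
have [i1 /ereal_lty_bound[V1 [V10 v1]]] := rho1_BV.
have [c [c0 rc]] := ess_inf_on_gt0_bound rho_gt0.
have [M [M0 PerM]] := limn_esup_lty_bound Per_bounded.
have mO := open_measurable_Rd Omega_open.
pose V := V0 + V1; have V_ge0 : 0 <= V by rewrite addr_ge0.
have V0V : (Defs.variation Omega rho0 <= V%:E)%E by apply: le_trans v0 _; rewrite lee_fin lerDl.
have V1V : (Defs.variation Omega rho1 <= V%:E)%E by apply: le_trans v1 _; rewrite lee_fin lerDr.
pose C := (4 * M + 2 * V) / c.
have C0 : 0 <= C by rewrite divr_ge0 ?addr_ge0 ?mulr_ge0// ltW.
have sA : \forall k \near \oo, shift_bound Omega C (eps k) (A k).
  apply: filterS PerM => k Perk; apply: small_shifts_bound => // i t r t0 te tr.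
  exact: (Per_axis_shift V_ge0 Omega_open Omega_bounded i0 V0V i1 V1V
    rho0_ge0 rho1_ge0 c0 rc).
have [s [B [sinc mB BO sB]]] := set_compactness Omega_open Omega_bounded A_measurable A_sub C0
  eps_gt0 eps_cvg0 sA.
have soo := increasing_seq_cvg sinc.
exists s, B; split=> //.
  apply: (@squeeze_cvge _ _ _ _ (fun=> 0%E) _ (fun k => (2 * 2^-1 ^+ k)%:E)); last 2 first.
  - exact: cvg_cst.
  - apply: cvg_EFin; first exact: nearW.
    have c2 : (GRing.exp (2^-1 : R)) @ \oo --> (0 : R) by apply: cvg_expr; rewrite ger0_norm; lra.
    by rewrite -(mulr0 2); apply: cvgMr.
  apply: nearW => k; rewrite integral_dist_indic//.
  by rewrite measure_ge0 sB.
apply: (shift_bound_finite_perimeter Omega_open Omega_bounded mB BO C0).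
apply: (@shift_bound_limit _ _ Omega C (A \o s) (eps \o s) B) => //.
- exact: cvg_comp soo eps_cvg0.
- exact: (soo _ sA).
Qed.
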